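(* Let $\sigma_n$ be a uniformly random square permutation of size $n$. Then $\mathbb P(\sigma_n\in\rho(\Omega_n))=1-o(1)$ as $n\to\infty$.
   Context: Square permutations. For a permutation $\sigma$ of $[n]$, a point $(i,\sigma(i))$ is a record if $\sigma(i)$ is larger than all $\sigma(j)$ with $j<i$, or smaller than all of these, or larger than all $\sigma(j)$ with $j>i$, or smaller than all of these. $\sigma$ is square if all its points are records; $Sq(n)$ is the set of square permutations of size $n$. Counting functions. For $X\in\{U,D\}^n$ and a label $A\in\{U,D\}$, $ct_A(i)$ is the number of $A$'s among $X_1,\dots,X_i$ ($ct_A(0)=0$), and $pos_A(i)$ is the index of the $i$-th $A$ in $X$, with $pos_A(0)=0$ and $pos_A(i)=n$ if $i>ct_A(n)$. The functions $ct_L,ct_R,pos_L,pos_R$ are defined in the same way from $Y\in\{L,R\}^n$. Petrov conditions. A label $A$ satisfies the Petrov conditions if: (1) $|ct_A(i)-ct_A(j)-\frac12(i-j)|<n^{0.4}$ for all $0\le i,j\le n$ with $|i-j|<n^{0.6}$; (2) $|ct_A(i)-ct_A(j)-\frac12(i-j)|<\frac12|i-j|^{0.6}$ for all $0\le i,j\le n$ with $|i-j|>n^{0.3}$; (3) $|pos_A(i)-pos_A(j)-2(i-j)|<n^{0.4}$ for all $0\le i,j\le ct_A(n)$ with $|i-j|<n^{0.6}$; (4) $|pos_A(i)-pos_A(j)-2(i-j)|<2|i-j|^{0.6}$ for all $0\le i,j\le ct_A(n)$ with $|i-j|>n^{0.3}$. The sequence $X$ (resp. $Y$) satisfies the Petrov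 conditions if both its labels $U,D$ (resp. $L,R$) do. Regular anchored pairs. $\Omega_n$ is the set of triples $(X,Y,z_0)\in\{U,D\}^n\times\{L,R\}^n\times[n]$ that are good, i.e. $X_1=X_n=X_{z_0}=D$ and $Y_1=Y_n=L$, such that $X$ and $Y$ satisfy the Petrov conditions and $n^{0.9}\le z_0\le n-n^{0.9}$. The map $\rho$. For $(X,Y,z_0)\in\Omega_n$ let $z_2=pos_U(ct_L(n)-ct_D(z_0))$ and $\Lambda_1=\{(pos_D(i),pos_L(ct_D(z_0)+1-i)):1\le i\le ct_D(z_0)\}$, $\Lambda_2=\{(pos_U(i),pos_L(ct_D(z_0)+i)):1\le i\le ct_U(z_2)\}$, $\Lambda_3=\{(pos_D(i),pos_R(i-ct_D(z_0))):ct_D(z_0)+1\le i\le ct_D(n)\}$, $\Lambda_4=\{(pos_U(i),pos_R(n-ct_D(z_0)+1-i)):ct_U(z_2)+1\le i\le ct_U(n)\}$. For $n$ large enough, $\Lambda_1\cup\Lambda_2\cup\Lambda_3\cup\Lambda_4$ is, for every $(X,Y,z_0)\in\Omega_n$, the diagram $\{(i,\sigma(i)):i\in[n]\}$ of a permutation $\sigma$ of $[n]$, and $\rho(X,Y,z_0)$ denotes this permutation. *)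

(* Defs.v *)
From HB Require Import structures.
From mathcomp Require Import all_boot all_order all_algebra all_fingroup.
From mathcomp Require Import all_classical all_reals all_analysis.

Set Implicit Arguments.
Unset Strict Implicit.
Unset Printing Implicit Defensive.

Import Order.TTheory GRing.Theory Num.Theory numFieldNormedType.Exports.

Local Open Scope classical_set_scope.
Local Open Scope ring_scope.

(* [n] = {1, ..., n} is represented by 'I_n for the domain and range of
   permutations, the ordinal i standing for i.+1.  All other positions
   (indices of letters, points of diagrams, z0) are 1-based naturals. *)

Definition is_record (n : nat) (s : {perm 'I_n}) (i : 'I_n) : bool :=
  [|| [forall j : 'I_n, (j < i)%N ==> (s j < s i)%N],
      [forall j : 'I_n, (j < i)%N ==> (s i < s j)%N],
      [forall j : 'I_n, (i < j)%N ==> (s j < s i)%N] |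
      [forall j : 'I_n, (i < j)%N ==> (s i < s j)%N]].

Definition Sq (n : nat) : {set {perm 'I_n}} :=
  finset (fun s : {perm 'I_n} => [forall i, is_record s i]).

Inductive UD := U | D.
Inductive LR := L | R.

Definition UD_to_bool (a : UD) : bool := if a is U then true else false.
Definition bool_to_UD (b : bool) : UD := if b then U else D.
Lemma UD_to_boolK : cancel UD_to_bool bool_to_UD. Proof. by case. Qed.
HB.instance Definition _ := Finite.copy UD (can_type UD_to_boolK).

Definition LR_to_bool (a : LR) : bool := if a is L then true else false.
Definition bool_to_LR (b : bool) : LR := if b then L else R.
Lemma LR_to_boolK : cancel LR_to_bool bool_to_LR. Proof. by case. Qed.
HB.instance Definition _ := Finite.copy LR (can_type LR_to_boolK).

Section Words.
Variables (T : eqType) (n : nat).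
Implicit Types (X : n.-tuple T) (A : T).

(* X_k = A, for 1 <= k <= n; false when k is out of this range. *)
Definition letter_is X (k : nat) A : bool :=
  (0 < k)%N && (onth X k.-1 == Some A).

Definition ct X A (i : nat) : nat := count_mem A (take i X).

(* The i-th entry (counted from 0) of 0 :: [positions of A in X], with
   default value n; hence pos X A 0 = 0 and pos X A i = n for i > ct X A n. *)
Definition pos X A (i : nat) : nat :=
  nth n (0%N :: [seq k <- iota 1 n | letter_is X k A]) i.

Section Petrov.
Variable K : realType.

Definition petrov_label X A : Prop :=
  let N : K := n%:R in
  let c (i : nat) : K := (ct X A i)%:R in
  let p (i : nat) : K := (pos X A i)%:R in
  let dist (i j : nat) : K := `|i%:R - j%:R| in
  [/\ forall i j : nat, (i <= n)%N -> (j <= n)%N ->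
        dist i j < N `^ (6 / 10) ->
        `|c i - c j - 1 / 2 * (i%:R - j%:R)| < N `^ (4 / 10),
      forall i j : nat, (i <= n)%N -> (j <= n)%N ->
        N `^ (3 / 10) < dist i j ->
        `|c i - c j - 1 / 2 * (i%:R - j%:R)| < 1 / 2 * dist i j `^ (6 / 10),
      forall i j : nat, (i <= ct X A n)%N -> (j <= ct X A n)%N ->
        dist i j < N `^ (6 / 10) ->
        `|p i - p j - 2 * (i%:R - j%:R)| < N `^ (4 / 10) &
      forall i j : nat, (i <= ct X A n)%N -> (j <= ct X A n)%N ->
        N `^ (3 / 10) < dist i j ->
        `|p i - p j - 2 * (i%:R - j%:R)| < 2 * dist i j `^ (6 / 10)].

Definition petrov X : Prop := forall A, petrov_label X A.

End Petrov.
End Words.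

Definition triple (n : nat) : Type := (n.-tuple UD * n.-tuple LR * nat)%type.

Definition good (n : nat) (w : triple n) : Prop :=
  let: (X, Y, z0) := w in
  [/\ letter_is X 1 D, letter_is X n D, letter_is X z0 D,
      letter_is Y 1 L & letter_is Y n L].

Definition Omega (K : realType) (n : nat) : set (triple n) :=
  [set w | let: (X, Y, z0) := w in
    [/\ (1 <= z0 <= n)%N, good w, petrov K X, petrov K Y &
        n%:R `^ (9 / 10) <= z0%:R :> K /\
        z0%:R <= n%:R - n%:R `^ (9 / 10) :> K]].

Arguments Omega K n : clear implicits.

Definition diagram (n : nat) (s : {perm 'I_n}) : set (nat * nat) :=
  [set (i.+1, (s i).+1) | i in [set: 'I_n]].

(* The natural-number subtractions below are truncated.  On Omega, for n large
   enough, every difference involved is nonnegative. *)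
Section Lambda.
Variables (n : nat) (w : triple n).
Let X := w.1.1.
Let Y := w.1.2.
Let z0 := w.2.

Definition z2 : nat := pos X U (ct Y L n - ct X D z0).

Definition Lambda1 : set (nat * nat) :=
  [set (pos X D i, pos Y L (ct X D z0 + 1 - i)%N)
    | i in [set i : nat | (1 <= i <= ct X D z0)%N]].

Definition Lambda2 : set (nat * nat) :=
  [set (pos X U i, pos Y L (ct X D z0 + i)%N)
    | i in [set i : nat | (1 <= i <= ct X U z2)%N]].

Definition Lambda3 : set (nat * nat) :=
  [set (pos X D i, pos Y R (i - ct X D z0)%N)
    | i in [set i : nat | (ct X D z0 + 1 <= i <= ct X D n)%N]].

Definition Lambda4 : set (nat * nat) :=
  [set (pos X U i, pos Y R (n - ct X D z0 + 1 - i)%N)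
    | i in [set i : nat | (ct X U z2 + 1 <= i <= ct X U n)%N]].

Definition Lambda : set (nat * nat) :=
  Lambda1 `|` Lambda2 `|` Lambda3 `|` Lambda4.

End Lambda.

(* The permutation with diagram Lambda w (necessarily unique), or None if there
   is no such permutation, which may happen on Omega for small n only. *)
Definition rho (n : nat) (w : triple n) : option {perm 'I_n} :=
  [pick s : {perm 'I_n} | `[< diagram s = Lambda w >]].

Definition rho_image (K : realType) (n : nat) : set {perm 'I_n} :=
  [set s | exists2 w, Omega K n w & rho w = Some s].

Arguments rho_image K n : clear implicits.

Definition uniform_random (K : realType) (d : measure_display)
    (T : measurableType d) (P : probability T K)
    (S : finType) (A : {set S}) (sigma : T -> S) : Prop :=
  forall s : S, measurable (sigma @^-1` [set s]) /\
    P (sigma @^-1` [set s]) = (if s \in A then #|A|%:R^-1 else 0)%:E.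

(* Main.v *)
(* A square permutation s is encoded by the triple (X, Y, z0) where X_i = D iff
   the point of column i is a left-to-right or right-to-left minimum, Y_v = L iff
   the point of row v is a left-to-right minimum or maximum, and s z0 = 1.  This
   triple is good, and it determines s, so |Sq n| is at most the number of good
   triples, which is at least n 4^n / 32.
   Conversely, as soon as the counting functions of X and Y are within o(n^(9/10))
   of i / 2 and z0 is n^(9/10) away from the ends, the sets Lambda_1, ..., Lambda_4
   stay close to the four sides of a rectangle far from degenerate; then Lambda is
   the diagram of a square permutation whose triple is (X, Y, z0).  Hence
   |rho(Omega_n) /\ Sq n| is at least the number of such triples.
   With q = n^(1/100), a Chernoff bound shows that for all but a negligible
   proportion of words |ct j - ct i - (j - i) / 2| <= q^2 sqrt (j - i) for all
   i <= j, and this single estimate implies the four Petrov conditions. *)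
Require Import Defs.
From mathcomp Require Import all_boot all_order all_algebra all_fingroup.
From mathcomp Require Import all_classical all_reals all_analysis.
From mathcomp Require Import zify ring lra.
Import Order.TTheory GRing.Theory Num.Theory numFieldNormedType.Exports.

Set Implicit Arguments.
Unset Strict Implicit.
Unset Printing Implicit Defensive.

(** * Counting functions of words *)

Section WordTheory.
Variables (T : eqType) (n : nat).
Implicit Types (X : n.-tuple T) (A B : T).

Lemma letter_isS X (i : 'I_n) A : letter_is X i.+1 A = (tnth X i == A).
Proof.
rewrite /letter_is /= onthE (nth_map (tnth X i)) ?size_tuple // -tnth_nth.
by apply/eqP/eqP => [[]|->].
Qed.

Lemma letter_is_bound X k A : letter_is X k A -> 0 < k <= n.
Proof.
case: k => // k; rewrite /letter_is /=; case: (ltnP k n) => // lenk.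
by rewrite onth_default ?size_tuple.
Qed.

Lemma ct0 X A : ct X A 0 = 0.
Proof. by rewrite /ct take0. Qed.

Lemma ctS X A (i : nat) : i < n -> ct X A i.+1 = ct X A i + letter_is X i.+1 A.
Proof.
move=> ltin; have x0 := tnth X (Ordinal ltin).
rewrite (letter_isS X (Ordinal ltin)) (tnth_nth x0) /ct.
by rewrite (take_nth x0) ?size_tuple // -cats1 count_cat /= addn0 eq_sym.
Qed.

(** [pos] lists the positions that satisfy [letter_is]; with [ct] in the same form, ranks and counts
    become sizes of filtered lists. *)
Lemma ct_count X A k : k <= n -> ct X A k = count (letter_is X ^~ A) (iota 1 k).
Proof.
elim: k => [_|k IHk ltkn]; first by rewrite ct0.
by rewrite ctS // IHk 1?ltnW // -(addn1 k) iotaD count_cat /= addn0 addn1 add1n.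
Qed.

Lemma leq_ct X A i j : i <= j <= n -> ct X A i <= ct X A j.
Proof.
case/andP=> leij lejn; rewrite !ct_count //; last exact: leq_trans lejn.
by rewrite -(subnKC leij) iotaD count_cat leq_addr.
Qed.

Lemma ltn_ct X A i j : i < j -> letter_is X j A -> ct X A i < ct X A j.
Proof.
move=> ltij Xj; case/letter_is_bound/andP: (Xj) => _ lejn.
case: j => // j in ltij Xj lejn *; rewrite ctS // Xj addn1 ltnS.
by apply: leq_ct; rewrite -ltnS ltij ltnW.
Qed.

(** The hypothesis says that the alphabet consists of the two distinct letters A and B, so every
    position adds one to exactly one of the counts. *)
Lemma ct_compl X A B k : (forall t, (t == A) = (t != B)) -> k <= n ->
  ct X A k + ct X B k = k.
Proof.
move=> AB; elim: k => [_|k IHk ltkn]; first by rewrite !ct0.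
rewrite !ctS // !(letter_isS X (Ordinal ltkn)) AB.
have := IHk (ltnW ltkn); case: (_ == B) => /=; lia.
Qed.

Lemma pos0 X A : pos X A 0 = 0.
Proof. by []. Qed.

Lemma pos_ct X A k : letter_is X k A -> pos X A (ct X A k) = k.
Proof.
move=> Xk; case/letter_is_bound/andP: (Xk); case: k => // k in Xk * => _ ltkn.
rewrite ctS // Xk addn1 /pos /= ct_count; last exact: ltnW.
have -> : iota 1 n = iota 1 k ++ k.+1 :: iota k.+2 (n - k.+1).
  have en : n = k + (1 + (n - k.+1)) by lia.
  by rewrite [in LHS]en !iotaD /= add1n addn1.
by rewrite filter_cat nth_cat size_filter ltnn subnn /= Xk.
Qed.

(** By [pos_ct], the entry whose rank is the count at [pos X A i] is [pos X A i] itself. The entries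
    of the list of positions are distinct, so this rank is i. *)
Lemma pos_spec X A i : 0 < i <= ct X A n ->
  letter_is X (pos X A i) A /\ ct X A (pos X A i) = i.
Proof.
case: i => // i; rewrite /= ct_count // => lti.
set s := [seq k <- iota 1 n | letter_is X k A].
have szs : size s = ct X A n by rewrite size_filter ct_count.
have lts : i < size s by rewrite size_filter.
have pE : pos X A i.+1 = nth n s i by [].
have Xp : letter_is X (pos X A i.+1) A.
  by have := mem_nth n lts; rewrite -pE mem_filter => /andP[].
split=> //; case/letter_is_bound/andP: (Xp) => p0 pn.
have := pos_ct Xp; have := ltn_ct p0 Xp.
have := @leq_ct X A (pos X A i.+1) n; rewrite pn leqnn => /(_ isT).
case: (ct X A (pos X A i.+1)) => // j; rewrite -szs => ltj _.
rewrite [RHS]pE [LHS]/(nth n s j) => /eqP; rewrite nth_uniq //.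
  by move/eqP->.
by rewrite filter_uniq // iota_uniq.
Qed.

End WordTheory.

(** * The permutation of a balanced good triple *)

(* [lia] on the bare (in)equalities of the context: it is very slow when it also
   has to process implications and letter tests. *)
Ltac nat_arith :=
  repeat match goal with
  | H : is_true (_ <= _ <= _) |- _ => case/andP: H => ? ?
  | H : is_true (_ < _ <= _) |- _ => case/andP: H => ? ?
  end;
  repeat match goal with
  | H : ?T |- _ => lazymatch T with
    | is_true (leq _ _) => fail
    | @eq nat _ _ => fail
    | nat => fail
    | _ => clear H
    end
  end;
  repeat match goal with
  | H : context [ct ?X ?A ?i] |- _ =>
      let c := fresh "c" in set c := (ct X A i) in *; clearbody c
  | H : context [pos ?X ?A ?i] |- _ =>
      let c := fresh "p" in set c := (pos X A i) in *; clearbody c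
  end; lia.

Lemma eqUD t : (t == U) = (t != D). Proof. by case: t. Qed.
Lemma eqDU t : (t == D) = (t != U). Proof. by case: t. Qed.
Lemma eqLR t : (t == L) = (t != R). Proof. by case: t. Qed.
Lemma eqRL t : (t == R) = (t != L). Proof. by case: t. Qed.

Section RhoFun.
Variables (n E z0 : nat) (X : n.-tuple UD) (Y : n.-tuple LR).

(** Both words satisfy |2 ct(x) - x| <= E, written without subtraction over the naturals. The
    margins on z0 keep the four pieces of Lambda apart on the scale E, which reduces the geometry to
    linear arithmetic. *)
Definition balanced : Prop :=
  [/\ forall x, x <= n -> x <= 2 * ct X D x + E /\ 2 * ct X D x <= x + E,
      forall y, y <= n -> y <= 2 * ct Y L y + E /\ 2 * ct Y L y <= y + E,
      10 * E + 20 <= z0 & z0 + 10 * E + 20 <= n].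

Hypothesis Hbal : balanced.
Hypothesis Hgood : good (X, Y, z0).

Let a := ct X D z0.
Let m := ct Y L n - a.

(** Lambda read column by column: the letter of x and its rank among equal letters select the piece
    and the row. The threshold [m] is the number of U's up to z2. *)
Definition rho_fun (x : nat) : nat :=
  if letter_is X x D then
    if ct X D x <= a then pos Y L (a + 1 - ct X D x)
    else pos Y R (ct X D x - a)
  else if ct X U x <= m then pos Y L (a + ct X U x)
  else pos Y R (n - a + 1 - ct X U x).

(* [on_Lambdak x y]: the point (x, y) lies on Lambda_k, told from the letters of
   the column x and of the row y and from their ranks. *)
Definition on_Lambda1 x y := [/\ letter_is X x D, 0 < ct X D x <= a, letter_is Y y L &
  ct Y L y + ct X D x = a + 1].
Definition on_Lambda2 x y := [/\ letter_is X x U, 0 < ct X U x <= m, letter_is Y y L &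
  ct Y L y = a + ct X U x].
Definition on_Lambda3 x y := [/\ letter_is X x D, a < ct X D x <= ct X D n, letter_is Y y R &
  ct Y R y + a = ct X D x].
Definition on_Lambda4 x y := [/\ letter_is X x U, m < ct X U x <= ct X U n, letter_is Y y R &
  ct Y R y + ct X U x + a = n + 1].

Lemma XU x : 0 < x <= n -> letter_is X x U = ~~ letter_is X x D.
Proof.
by case: x => // x /= ltxn; rewrite !(letter_isS X (Ordinal ltxn)) eqUD.
Qed.

Lemma YR y : 0 < y <= n -> letter_is Y y R = ~~ letter_is Y y L.
Proof.
by case: y => // y /= ltyn; rewrite !(letter_isS Y (Ordinal ltyn)) eqRL.
Qed.

Lemma ct_X_bounds x : x <= n -> [/\ ct X D x + ct X U x = x,
   x <= 2 * ct X D x + E & 2 * ct X D x <= x + E].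
Proof.
by move=> lexn; rewrite (ct_compl X eqDU lexn); case: Hbal => /(_ x lexn)[].
Qed.

Lemma ct_Y_bounds y : y <= n -> [/\ ct Y L y + ct Y R y = y,
   y <= 2 * ct Y L y + E & 2 * ct Y L y <= y + E].
Proof.
by move=> leyn; rewrite (ct_compl Y eqLR leyn); case: Hbal => _ /(_ y leyn)[].
Qed.

Lemma total_ct_bounds : [/\ 10 * E + 20 <= z0, z0 + 10 * E + 20 <= n,
  ct X D n + ct X U n = n /\ ct Y L n + ct Y R n = n,
  n <= 2 * ct X D n + E /\ 2 * ct X D n <= n + E &
  [/\ n <= 2 * ct Y L n + E, 2 * ct Y L n <= n + E,
  z0 <= 2 * a + E, 2 * a <= z0 + E & m + a = ct Y L n]].
Proof.
have [? ? ?] := ct_X_bounds (leqnn n); have [? ? ?] := ct_Y_bounds (leqnn n).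
case: Hbal => _ _ z0_lo z0_hi; have lez0n : z0 <= n by nat_arith.
have [_ az1 az2] := ct_X_bounds lez0n; rewrite -/a in az1 az2; split=> //.
by split=> //; rewrite /m; nat_arith.
Qed.

Lemma ct_gt0 (T : eqType) (W : n.-tuple T) A x : letter_is W x A -> 0 < ct W A x.
Proof.
move=> Wx; case/letter_is_bound/andP: (Wx) => x0 _.
by have := ltn_ct x0 Wx; rewrite ct0.
Qed.

(** Balance keeps every rank passed to [pos] between 1 and the total count of its letter, so the
    default value of [pos] is never met. *)
Lemma rho_funP x : 0 < x <= n ->
  0 < rho_fun x <= n /\ [\/ on_Lambda1 x (rho_fun x), on_Lambda2 x (rho_fun x),
      on_Lambda3 x (rho_fun x) | on_Lambda4 x (rho_fun x)].
Proof.
move=> xn; have lexn : x <= n by case/andP: xn.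
have [? ? [? ?] [? ?] [? ? ? ? ?]] := total_ct_bounds.
have xD1 : ct X D x <= ct X D n by apply: leq_ct; rewrite lexn /=.
have xU1 : ct X U x <= ct X U n by apply: leq_ct; rewrite lexn /=.
have [? ? ?] := ct_X_bounds lexn.
have posP A i : 0 < i <= ct Y A n -> [/\ 0 < pos Y A i <= n,
    letter_is Y (pos Y A i) A & ct Y A (pos Y A i) = i].
  by case/pos_spec=> Yp cp; split=> //; apply: letter_is_bound Yp.
rewrite /rho_fun; have := XU xn; case: ifPn => xD /= xU; case: ifPn => cx;
  rewrite -?ltnNge in cx.
- have pD := ct_gt0 xD.
  have [|bp Yp cp] := posP L (a + 1 - ct X D x); first by nat_arith.
  by split=> //; constructor 1; split=> //; nat_arith.
- have [|bp Yp cp] := posP R (ct X D x - a); first by nat_arith.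
  by split=> //; constructor 3; split=> //; nat_arith.
- have pU := ct_gt0 xU.
  have [|bp Yp cp] := posP L (a + ct X U x); first by nat_arith.
  by split=> //; constructor 2; split=> //; nat_arith.
have [|bp Yp cp] := posP R (n - a + 1 - ct X U x); first by nat_arith.
by split=> //; constructor 4; split=> //; nat_arith.
Qed.

Lemma rho_fun_bound x : 0 < x <= n -> 0 < rho_fun x <= n.
Proof. by case/rho_funP. Qed.

(** The row determines the piece: L rows of rank at most a lie on Lambda_1 and the others on
    Lambda_2; R rows of rank at most ct_D(n) - a lie on Lambda_3 and the others on Lambda_4. Within
    a piece the rank of the row gives that of the column. *)
Lemma rho_fun_inj x x' : 0 < x <= n -> 0 < x' <= n ->
  rho_fun x = rho_fun x' -> x = x'.
Proof.
move=> xn xn' e; have [yb] := rho_funP xn; have [_] := rho_funP xn'; rewrite -e.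
have := YR yb; move: (rho_fun x) => y YRy.
have sameX A : letter_is X x A -> letter_is X x' A -> ct X A x = ct X A x' -> x = x'.
  by move=> xA xA' ec; rewrite -(pos_ct xA) ec pos_ct.
have [? ? [? ?] [? ?] [? ? ? ? ?]] := total_ct_bounds.
case=> -[xA cx Yy cy]; case=> -[xA' cx' Yy' cy'];
  try (by exfalso; rewrite Yy Yy' in YRy);
  first [by apply: (sameX D) => //; nat_arith | by apply: (sameX U) => //; nat_arith
        |exfalso; nat_arith].
Qed.

Lemma good_letters : [/\ letter_is X 1 D, letter_is X n D, letter_is X z0 D,
  letter_is Y 1 L & letter_is Y n L].
Proof. exact: Hgood. Qed.

Lemma rho_fun_Lambda1 x : letter_is X x D -> ct X D x <= a -> on_Lambda1 x (rho_fun x).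
Proof.
move=> xD cx; have xn := letter_is_bound xD; have := XU xn; rewrite xD /= => xU.
by have [_ [] // [xA cx' _ _]] := rho_funP xn;
  [rewrite xU in xA | nat_arith | rewrite xU in xA].
Qed.

Lemma rho_fun_Lambda2 x : letter_is X x U -> ct X U x <= m -> on_Lambda2 x (rho_fun x).
Proof.
move=> xU cx; have xn := letter_is_bound xU; have := XU xn; rewrite xU => xD.
have [_ [] // [xA cx' _ _]] := rho_funP xn; [| | nat_arith]; by rewrite xA in xD.
Qed.

Lemma rho_fun_Lambda3 x : letter_is X x D -> a < ct X D x -> on_Lambda3 x (rho_fun x).
Proof.
move=> xD cx; have xn := letter_is_bound xD; have := XU xn; rewrite xD /= => xU.
have [_ [] // [xA cx' _ _]] := rho_funP xn; [nat_arith | |]; by rewrite xU in xA.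
Qed.


Lemma rho_fun_Lambda4 x : letter_is X x U -> m < ct X U x -> on_Lambda4 x (rho_fun x).
Proof.
move=> xU cx; have xn := letter_is_bound xU; have := XU xn; rewrite xU => xD.
by have [_ [] // [xA cx' _ _]] := rho_funP xn;
  [rewrite xA in xD | nat_arith | rewrite xA in xD].
Qed.

(** Column z0 has rank a among the D's, so Lambda_1 sends it to the first L, which is row 1. *)
Lemma rho_fun_z0 : rho_fun z0 = 1.
Proof.
have [_ _ Xz0 Y1 _] := good_letters.
have [_ ? Yy cy] := rho_fun_Lambda1 Xz0 (leqnn _).
have := ct_gt0 Y1; case: (ltngtP (rho_fun z0) 1) => // [|lt1 p1].
  by have := letter_is_bound Yy; case: (rho_fun z0).
by have ? := ltn_ct lt1 Yy; exfalso; rewrite -/a in cy; nat_arith.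
Qed.


Lemma ltn_of_ct (T : eqType) (W : n.-tuple T) A i j :
  i <= n -> ct W A i < ct W A j -> i < j.
Proof.
by move=> lein; apply: contraTltn => leji; rewrite -leqNgt leq_ct // leji.
Qed.

(* For x' < x: points of Lambda_1 and of Lambda_4 lie near the lines x + y = 2a
   and x + y = 2(n - a), points of Lambda_2 and of Lambda_3 near the lines
   y - x = 2a and x - y = 2a.  These lines are much further apart than E. *)
Lemma rho_fun_lt x' x : 0 < x' -> x' < x -> x <= n ->
  let y' := rho_fun x' in let y := rho_fun x in
  [/\ on_Lambda1 x y -> y < y', on_Lambda2 x y -> y' < y, on_Lambda3 x' y' -> y' < y &
      on_Lambda4 x' y' -> y < y'].
Proof.
move=> x'0 ltx lexn /=.
have xn : 0 < x <= n by rewrite lexn (leq_trans _ ltx).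
have x'n : 0 < x' <= n by rewrite x'0 (leq_trans (ltnW ltx)).
have neqy : rho_fun x' <> rho_fun x.
  by move/(rho_fun_inj x'n xn) => e; rewrite e ltnn in ltx.
have [/andP[y0 yn] clx] := rho_funP xn.
have [/andP[y'0 y'n] clx'] := rho_funP x'n.
move: (rho_fun x) (rho_fun x') => y y' in neqy y0 yn y'0 y'n clx clx' *.
have cle : forall A, ct X A x' <= ct X A x by move=> A; apply: leq_ct; rewrite ltnW.
have cDle := cle D; have cUle := cle U; have clt := ltn_ct ltx => {cle}.
case/andP: x'n => _ lex'n.
have [? ? [? ?] [? ?] [? ? ? ? ?]] := total_ct_bounds.
have [? ? ?] := ct_X_bounds lexn; have [? ? ?] := ct_X_bounds lex'n.
have [? ? ?] := ct_Y_bounds yn; have [? ? ?] := ct_Y_bounds y'n.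
have yle A : y' < y -> ct Y A y' <= ct Y A y by move=> lty; apply: leq_ct; rewrite ltnW.
have yge A : y < y' -> ct Y A y <= ct Y A y' by move=> lty; apply: leq_ct; rewrite ltnW.
have [lty|lty|//] := ltngtP y' y; [have yL := yle L lty; have yR := yle R lty
  | have yL := yge L lty; have yR := yge R lty];
  clear yle yge; split=> // -[xA cx Yy cy]; exfalso;
  [case: clx' | case: clx | case: clx' | case: clx];
  move=> -[xA' cx' Yy' cy'];
  first [have xlt := clt _ _ _ _ xA | have xlt := clt _ _ _ _ xA']; nat_arith.
Qed.


Lemma ltn_letter (T : eqType) (W : n.-tuple T) A B i j : A != B ->
  letter_is W i A -> letter_is W j B -> i <= j -> i < j.
Proof.
move=> neAB Wi Wj; rewrite leq_eqVlt => /predU1P[e|//]; rewrite -e in Wj.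
case: i Wi Wj {e} => // i Wi; case/letter_is_bound/andP: (Wi) => _ ltin.
move: Wi; rewrite !(letter_isS W (Ordinal ltin)) => /eqP -> /eqP e.
by rewrite e eqxx in neAB.
Qed.

Lemma pos_D_next x : x < n -> ct X D (pos X D (ct X D x).+1) = (ct X D x).+1 /\
  [/\ letter_is X (pos X D (ct X D x).+1) D, x < pos X D (ct X D x).+1 &
  pos X D (ct X D x).+1 <= n].
Proof.
move=> ltxn; have [_ Xn _ _ _] := good_letters.
have ltc := ltn_ct ltxn Xn.
have [Xp cp] : _ /\ _ := @pos_spec _ _ X D (ct X D x).+1 ltc.
split=> //; split=> //; last by case/andP: (letter_is_bound Xp).
by apply: (@ltn_of_ct _ X D); [apply: ltnW | rewrite cp].
Qed.

Lemma pos_ct_le (T : eqType) (W : n.-tuple T) A x : x <= n -> 0 < ct W A x ->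
  [/\ ct W A (pos W A (ct W A x)) = ct W A x,
      letter_is W (pos W A (ct W A x)) A & 0 < pos W A (ct W A x) <= x].
Proof.
move=> lexn cx.
have [|Wp cp] := @pos_spec _ _ W A (ct W A x); first by rewrite cx leq_ct // lexn /=.
split=> //; case/andP: (letter_is_bound Wp) => -> pn /=.
by rewrite leqNgt; apply/negP => /ltn_ct/(_ Wp); rewrite cp ltnn.
Qed.

(** A U column is thus no right-to-left minimum. The witness is z0 for columns of Lambda_2 before
    z0, the next D column (on Lambda_3) for later columns of Lambda_2, and column n for Lambda_4. *)
Lemma rho_fun_U_right x : letter_is X x U ->
  exists x', [/\ x < x', x' <= n & rho_fun x' < rho_fun x].
Proof.
move=> xU; have xn := letter_is_bound xU; case/andP: (xn) => x0 lexn.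
have [X1 Xn Xz0 _ _] := good_letters.
have ltxn : x < n by apply: ltn_letter xU Xn lexn.
have [? ? [? ?] [? ?] [? ? ? ? ?]] := total_ct_bounds.
have [? ? ?] := ct_X_bounds lexn.
have [yn clx] := rho_funP xn; case/andP: (yn) => y0 leyn.
have [? ? ?] := ct_Y_bounds leyn.
have [lecm|ltmc] := leqP (ct X U x) m.
  have [_ cx Yy cy] := rho_fun_Lambda2 xU lecm.
  have [ltxz|lezx] := ltnP x z0.
    exists z0; split=> //; first by nat_arith.
    by rewrite rho_fun_z0; nat_arith.
  have [cp [Xp ltxp lepn]] := pos_D_next ltxn.
  exists (pos X D (ct X D x).+1); split=> //.
  have cz : a <= ct X D x by apply: leq_ct; rewrite lezx.
  have [|_ _ _ cy'] := rho_fun_Lambda3 Xp; first by rewrite cp.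
  have [|/andP[_ ley'n] _] := @rho_funP (pos X D (ct X D x).+1).
    exact: letter_is_bound Xp.
  have [? ? ?] := ct_Y_bounds ley'n.
  rewrite ltnNge; apply/negP => leyy'; rewrite cp in cy'; nat_arith.
exists n; split=> //.
have [|_ _ _ cy'] := rho_fun_Lambda3 Xn; first by nat_arith.
have [_ cx _ cy] := rho_fun_Lambda4 xU ltmc.
have /andP[_ ley'n] := rho_fun_bound (letter_is_bound Xn).
by apply: (@ltn_of_ct _ Y R) => //; nat_arith.
Qed.

(** A U column is thus no left-to-right minimum. The witness is column 1 for Lambda_2, z0 for
    columns of Lambda_4 after z0, and the last D column before x (on Lambda_1) for earlier columns
    of Lambda_4. *)
Lemma rho_fun_U_left x : letter_is X x U ->
  exists x', [/\ 0 < x', x' < x & rho_fun x' < rho_fun x].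
Proof.
move=> xU; have xn := letter_is_bound xU; case/andP: (xn) => x0 lexn.
have [X1 Xn Xz0 _ _] := good_letters.
have lt1x : 1 < x by apply: ltn_letter X1 xU x0.
have [? ? [? ?] [? ?] [? ? ? ? ?]] := total_ct_bounds.
have [? ? ?] := ct_X_bounds lexn.
have [yn clx] := rho_funP xn; case/andP: (yn) => y0 leyn.
have [? ? ?] := ct_Y_bounds leyn.
have c1 : ct X D 1 = 1.
  have := ct_gt0 X1; have l1n : 1 <= n by nat_arith.
  by have [? _ _] := ct_X_bounds l1n; move=> ?; nat_arith.
have [lecm|ltmc] := leqP (ct X U x) m.
  have [_ cx Yy cy] := rho_fun_Lambda2 xU lecm.
  exists 1; split=> //.
  have [|_ cx' _ cy'] := rho_fun_Lambda1 X1; first by nat_arith.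
  have /andP[_ ley'n] := rho_fun_bound (letter_is_bound X1).
  by apply: (@ltn_of_ct _ Y L) => //; nat_arith.
have [_ cx Yy cy] := rho_fun_Lambda4 xU ltmc.
have [lexz|ltzx] := leqP x z0; last first.
  exists z0; split=> //; first by nat_arith.
  by rewrite rho_fun_z0; nat_arith.
have c0 : 0 < ct X D x.
  by rewrite -c1; apply: leq_ct; rewrite x0.
have [cp Xp /andP[p0 plt]] := pos_ct_le lexn c0.
exists (pos X D (ct X D x)); split=> //; first exact: ltn_letter Xp xU plt.
have lec : ct X D x <= a by apply: leq_ct; rewrite lexz; nat_arith.
have [|_ _ _ cy'] := rho_fun_Lambda1 Xp; first by rewrite cp.
have [|/andP[_ ley'n] _] := @rho_funP (pos X D (ct X D x)).
  exact: letter_is_bound Xp.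
have [? ? ?] := ct_Y_bounds ley'n.
rewrite ltnNge; apply/negP => leyy'; rewrite cp in cy'; nat_arith.
Qed.

(** An R row is thus no left-to-right minimum: points of Lambda_3 have z0 to their left, and points
    of Lambda_4 lie in U columns. *)
Lemma rho_fun_R_left_lower x : 0 < x <= n -> letter_is Y (rho_fun x) R ->
  exists x', [/\ 0 < x', x' < x & rho_fun x' < rho_fun x].
Proof.
move=> xn yR; have [X1 Xn Xz0 Y1 _] := good_letters.
have [? ? [? ?] [? ?] [? ? ? ? ?]] := total_ct_bounds.
have [yn clx] := rho_funP xn; have := YR yn; rewrite yR => yL.
case: clx => -[xA cx Yy cy]; try (by rewrite Yy in yL).
  exists z0; split; first by nat_arith.
    by apply: (@ltn_of_ct _ X D); [nat_arith | rewrite -/a; case/andP: cx].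
  by rewrite rho_fun_z0; apply: ltn_letter Y1 yR _ => //; case/andP: yn.
exact: rho_fun_U_left.
Qed.

(** An R row is thus no left-to-right maximum. Past the m-th U, the witness is the column of that U,
    whose row has the top rank among the L's, as does row n; before, it is the last U column
    preceding x, a point of Lambda_2. *)
Lemma rho_fun_R_left_upper x : 0 < x <= n -> letter_is Y (rho_fun x) R ->
  exists x', [/\ 0 < x', x' < x & rho_fun x < rho_fun x'].
Proof.
move=> xn yR; have [X1 Xn Xz0 Y1 Yn] := good_letters.
case/andP: (xn) => x0 lexn.
have [? ? [? ?] [? ?] [? ? ? ? ?]] := total_ct_bounds.
have [? ? ?] := ct_X_bounds lexn.
have [yn clx] := rho_funP xn; case/andP: (yn) => y0 leyn.
have [? ? ?] := ct_Y_bounds leyn.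
have ltyn : rho_fun x < n by apply: ltn_letter yR Yn leyn.
have := YR yn; rewrite yR => yL.
have [lecm|ltmc] := leqP (ct X U x) m; last first.
  have [|Xp cp] := @pos_spec _ _ X U m; first by nat_arith.
  case/andP: (letter_is_bound Xp) => p0 pn; exists (pos X U m); split=> //.
    by apply: (@ltn_of_ct _ X U) => //; rewrite cp.
  have [|_ _ _ cy'] := rho_fun_Lambda2 Xp; first by rewrite cp.
  have [|/andP[_ ley'n] _] := @rho_funP (pos X U m); first exact: letter_is_bound Xp.
  have ltc := ltn_ct ltyn Yn.
  by apply: (@ltn_of_ct _ Y L) => //; rewrite cy' cp; nat_arith.
case: clx => -[xA cx Yy cy]; try (by rewrite Yy in yL); last by nat_arith.
have c0 : 0 < ct X U x by nat_arith.
have [cp Xp /andP[p0 plt]] := pos_ct_le lexn c0.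
exists (pos X U (ct X U x)); split=> //; first exact: ltn_letter Xp xA plt.
have [|_ _ _ cy'] := rho_fun_Lambda2 Xp; first by rewrite cp.
have [|/andP[_ ley'n] _] := @rho_funP (pos X U (ct X U x)).
  exact: letter_is_bound Xp.
have [? ? ?] := ct_Y_bounds ley'n.
rewrite ltnNge; apply/negP => leyy'; rewrite cp in cy'; nat_arith.
Qed.

Lemma Lambda_rho_fun : Lambda (X, Y, z0) =
  [set p | exists2 x, 0 < x <= n & p = (x, rho_fun x)]%classic.
Proof.
have [? ? [? ?] [? ?] [? ? ? ? ?]] := total_ct_bounds.
have pX A i : 0 < i <= ct X A n -> _ := @pos_spec _ _ X A i.
(* Since 0 < m <= ct_U(n), the count of U's up to z2 is m, so the ranges of Lambda_2 and Lambda_4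
   match the test in [rho_fun]. *)
have [|_ cz2] := pX U m; first by nat_arith.
have posP A k j : letter_is Y k A -> ct Y A k = j -> k = pos Y A j.
  by move=> Yk <-; rewrite pos_ct.
rewrite /Lambda /Lambda1 /Lambda2 /Lambda3 /Lambda4 /z2 /= -/a -/m cz2.
have len k A : k <= n -> ct X A k <= ct X A n by move=> lekn; apply: leq_ct; rewrite lekn /=.
have lezn : z0 <= n by nat_arith.
have lean := len _ D lezn.
apply/seteqP; split=> [p|_ [x xn ->]].
  have key A i y : 0 < i <= ct X A n ->
      (letter_is X (pos X A i) A -> ct X A (pos X A i) = i -> rho_fun (pos X A i) = y) ->
      exists2 x, 0 < x <= n & (pos X A i, y) = (x, rho_fun x).
    move=> /pX[Xp cp] H; exists (pos X A i); first exact: letter_is_bound Xp.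
    by rewrite H.
  case=> [[[|]|]|] /= -[i ib <-]; apply: key; try nat_arith; move=> Xp cp.
  - have [|_ _ Yy cy] := rho_fun_Lambda1 Xp; first by nat_arith.
    by apply: posP => //; nat_arith.
  - have [|_ _ Yy cy] := rho_fun_Lambda2 Xp; first by nat_arith.
    by apply: posP => //; nat_arith.
  - have [|_ _ Yy cy] := rho_fun_Lambda3 Xp; first by nat_arith.
    by apply: posP => //; nat_arith.
  have [|_ _ Yy cy] := rho_fun_Lambda4 Xp; first by nat_arith.
  by apply: posP => //; nat_arith.
have [_ clx] := rho_funP xn; case: clx => -[xA cx Yy cy].
- left; left; left; exists (ct X D x) => /=; first by nat_arith.
  by rewrite pos_ct //; congr pair; symmetry; apply: posP => //; nat_arith.
- left; left; right; exists (ct X U x) => /=; first by nat_arith.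
  by rewrite pos_ct //; congr pair; symmetry; apply: posP => //; nat_arith.
- left; right; exists (ct X D x) => /=; first by nat_arith.
  by rewrite pos_ct //; congr pair; symmetry; apply: posP => //; nat_arith.
right; exists (ct X U x) => /=; first by nat_arith.
by rewrite pos_ct //; congr pair; symmetry; apply: posP => //; nat_arith.
Qed.

End RhoFun.

(** * The words of a square permutation *)

Section Records.
Variable n : nat.
Implicit Types (s t : {perm 'I_n}) (i j : 'I_n).

Definition lrmax s i := [forall j : 'I_n, (j < i) ==> (s j < s i)].
Definition lrmin s i := [forall j : 'I_n, (j < i) ==> (s i < s j)].
Definition rlmax s i := [forall j : 'I_n, (i < j) ==> (s j < s i)].
Definition rlmin s i := [forall j : 'I_n, (i < j) ==> (s i < s j)].

Definition lower s i := lrmin s i || rlmin s i.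
Definition left_record s i := lrmin s i || lrmax s i.

Definition UD_word s : n.-tuple UD :=
  [tuple if lower s i then D else U | i < n].
Definition LR_word s : n.-tuple LR :=
  [tuple if left_record s ((s^-1)%g v) then L else R | v < n].

Lemma UD_wordD s i : letter_is (UD_word s) i.+1 D = lower s i.
Proof. by rewrite letter_isS tnth_mktuple; case: ifP. Qed.

Lemma LR_wordL s i : letter_is (LR_word s) (s i).+1 L = left_record s i.
Proof. by rewrite letter_isS tnth_mktuple permK; case: ifP. Qed.

Lemma lrmaxP s i : reflect (forall j, j < i -> s j < s i) (lrmax s i).
Proof. by apply: (iffP forallP) => H j; move/(_ j)/implyP: H. Qed.
Lemma lrminP s i : reflect (forall j, j < i -> s i < s j) (lrmin s i).
Proof. by apply: (iffP forallP) => H j; move/(_ j)/implyP: H. Qed.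
Lemma rlmaxP s i : reflect (forall j, i < j -> s j < s i) (rlmax s i).
Proof. by apply: (iffP forallP) => H j; move/(_ j)/implyP: H. Qed.
Lemma rlminP s i : reflect (forall j, i < j -> s i < s j) (rlmin s i).
Proof. by apply: (iffP forallP) => H j; move/(_ j)/implyP: H. Qed.

Lemma Sq_record s i : s \in Sq n -> [|| lower s i, lrmax s i | rlmax s i].
Proof.
rewrite inE => /forallP/(_ i); rewrite /is_record /lower -!/(lrmax s i).
by rewrite -!/(lrmin s i) -!/(rlmax s i) -!/(rlmin s i) => /or4P[] ->; rewrite ?orbT.
Qed.

Section Prefix.
Variables (s t : {perm 'I_n}) (i : 'I_n).
Hypothesis st : forall j, j < i -> s j = t j.

Lemma prefix_unused v : (i <= (t^-1)%g v) -> i <= (s^-1)%g v.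
Proof.
apply: contraTT; rewrite -!ltnNge => ltj.
by rewrite -(permKV s v) (st ltj) permK.
Qed.

Lemma prefix_inv : i <= (s^-1)%g (t i).
Proof. by apply: prefix_unused; rewrite permK. Qed.

Lemma prefix_inv_eq : i = (s^-1)%g (t i) :> nat -> s i = t i.
Proof. by move/val_inj=> e; rewrite {1}e permKV. Qed.

Lemma rlmin_prefix : rlmin s i -> s i <= t i.
Proof.
move/rlminP=> H; have := prefix_inv; rewrite leq_eqVlt => /predU1P[/prefix_inv_eq->//|/H].
by rewrite permKV => /ltnW.
Qed.

Lemma rlmax_prefix : rlmax s i -> t i <= s i.
Proof.
move/rlmaxP=> H; have := prefix_inv; rewrite leq_eqVlt => /predU1P[/prefix_inv_eq->//|/H].
by rewrite permKV => /ltnW.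
Qed.

(** The row [t i] is met by s at column i or later. If later, and as a left-to-right minimum, it
    lies below [s i]. It cannot be a left-to-right maximum, because it lies below the first value,
    which s and t share. *)
Lemma lrmin_prefix : left_record s ((s^-1)%g (t i)) ->
  (forall j, j < i -> t i < t j) -> 0 < i -> t i <= s i.
Proof.
move=> Ls ti i0; have := prefix_inv; rewrite leq_eqVlt => /predU1P[/prefix_inv_eq->//|lti].
have z : 0 < n by apply: leq_ltn_trans (ltn_ord i).
case/orP: Ls => [/lrminP/(_ i lti)|/lrmaxP/(_ (Ordinal z))]; rewrite permKV.
  by move/ltnW.
have ltz : Ordinal z < (s^-1)%g (t i) by apply: leq_ltn_trans lti.
by move/(_ ltz); rewrite st // ltnNge ltnW // ti.
Qed.

Lemma lrmax_prefix : left_record s ((s^-1)%g (t i)) ->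
  (forall j, j < i -> t j < t i) -> 0 < i -> s i <= t i.
Proof.
move=> Ls ti i0; have := prefix_inv; rewrite leq_eqVlt => /predU1P[/prefix_inv_eq->//|lti].
have z : 0 < n by apply: leq_ltn_trans (ltn_ord i).
case/orP: Ls => [/lrminP/(_ (Ordinal z))|/lrmaxP/(_ i lti)]; rewrite permKV; last first.
  by move/ltnW.
have ltz : Ordinal z < (s^-1)%g (t i) by apply: leq_ltn_trans lti.
by move/(_ ltz); rewrite st // ltnNge ltnW // ti.
Qed.

(* The value n, if not yet used before i, is still to come at i or later in both
   permutations: so i cannot be a left-to-right maximum of one and only a
   right-to-left maximum of the other. *)
Lemma lrmax_rlmax_prefix : lrmax s i -> rlmax t i -> lrmax t i.
Proof.
move=> /lrmaxP si /rlmaxP ti; apply/lrmaxP => j ltji.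
have z : n.-1 < n by rewrite ltn_predL (leq_ltn_trans _ (ltn_ord i)).
have top (v : 'I_n) : v <= Ordinal z by rewrite /= -ltnS (ltn_predK z).
set k := (t^-1)%g (Ordinal z).
have tk : t k = Ordinal z by rewrite permKV.
have [ltki|ltik|ek] := ltngtP k i.
- by have := si k ltki; rewrite st // tk ltnNge top.
- by have := ti k ltik; rewrite tk ltnNge top.
rewrite -(val_inj ek) tk ltn_neqAle top andbT -tk.
by apply: contraTneq ltji => /val_inj/perm_inj ->; rewrite ek ltnn.
Qed.

End Prefix.

End Records.

(** * Reconstruction of a square permutation from its triple *)

Section Injectivity.
Variable n : nat.
Implicit Types (s t : {perm 'I_n.+1}) (i j : 'I_n.+1).

Definition min_pos s : 'I_n.+1 := (s^-1)%g ord0.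

Lemma min_posK s : s (min_pos s) = ord0.
Proof. by rewrite permKV. Qed.

(** A right-to-left minimum strictly before the column of the least value would have to lie below
    that value. *)
Lemma lower_lrmin s i : i <= min_pos s -> lower s i = lrmin s i.
Proof.
move=> leib; apply/orP/idP => [[//|/rlminP H]|->]; last by left.
move: leib; rewrite leq_eqVlt => /predU1P[/val_inj->|/H]; last by rewrite min_posK.
apply/lrminP=> j ltj; rewrite min_posK /= lt0n.
by apply: contraTneq ltj => e; rewrite -[j](permK s) (_ : s j = ord0) ?ltnn //; apply: val_inj.
Qed.

Lemma lower_rlmin s i : min_pos s < i -> lower s i = rlmin s i.
Proof.
move=> ltbi; apply/orP/idP => [[/lrminP/(_ _ ltbi)|//]|->]; last by right.
by rewrite min_posK.
Qed.

(* Counting the two sides shows that the words determine the first value. *)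
Lemma left_rows_image s :
  [set v in 'I_n.+1 | letter_is (LR_word s) v.+1 L && (v <= s ord0)]%SET =
  [set s j | j in [set j in 'I_n.+1 | letter_is (UD_word s) j.+1 D && (j <= min_pos s)]%SET]%SET.
Proof.
apply/setP=> v; rewrite -(permKV s v); move: ((s^-1)%g v) => j.
rewrite mem_imset; last exact: perm_inj.
rewrite !inE /= LR_wordL UD_wordD.
apply/andP/andP => [[Lj lej]|[]] .
  have minj : lrmin s j.
    case/orP: Lj => // /lrmaxP/(_ ord0); case: (posnP j) => [j0 _|_ /(_ isT)].
      by apply/lrminP => k; rewrite j0.
    by rewrite ltnNge lej.
  split; first by rewrite /lower minj.
  by rewrite leqNgt; apply/negP => /(lrminP _ _ minj); rewrite min_posK.
move=> low leb; rewrite lower_lrmin // in low; rewrite /left_record low; split=> //.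
case: (posnP j) => [j0|j0]; first by rewrite (_ : j = ord0) //; apply: val_inj.
exact/ltnW/(lrminP _ _ low ord0).
Qed.

(** The L rows up to the first value form nested sets for s and t, of equal size by
    [left_rows_image]. They coincide, and the larger one contains the first value of t. *)
Lemma first_value_le s t : UD_word s = UD_word t -> LR_word s = LR_word t ->
  min_pos s = min_pos t -> s ord0 <= t ord0 -> t ord0 <= s ord0.
Proof.
move=> eX eY eb lest.
pose rows (w u : {perm 'I_n.+1}) :=
  [set v in 'I_n.+1 | letter_is (LR_word w) v.+1 L && (v <= u ord0)]%SET.
have es := left_rows_image s; have et := left_rows_image t; rewrite -eX -eb in et.
rewrite -/(rows s s) in es; rewrite -/(rows t t) {1}/rows -eY -/(rows s t) in et.
set As := rows s s in es; set At := rows s t in et.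
have sub : As \subset At.
  by apply/fintype.subsetP => v; rewrite !inE /= => /andP[-> /= le]; apply: leq_trans lest.
have eA : As = At.
  apply/eqP; rewrite eqEcard sub et card_imset; last exact: perm_inj.
  by rewrite es card_imset ?leqnn ?andbT //; exact: perm_inj.
have : t ord0 \in At.
  rewrite !inE /= leqnn andbT eY LR_wordL /left_record; apply/orP; left.
  by apply/lrminP.
by rewrite -eA !inE /= => /andP[].
Qed.

(* Look at the first column where s and t could differ.  A right-to-left record
   takes the extreme unused value, a left-to-right record the next unused row
   labelled L below or above the first value: both are read off the words and
   the earlier columns. *)
Lemma square_words_inj s t : s \in Sq n.+1 -> t \in Sq n.+1 ->
  UD_word s = UD_word t -> LR_word s = LR_word t -> min_pos s = min_pos t -> s = t.
Proof.
move=> sS tS eX eY eb.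
suff H m : forall i, i < m -> s i = t i by apply/permP => i; apply: (H n.+1).
elim: m => // m IHm i; rewrite ltnS => leim.
have st j : j < i -> s j = t j by move=> ltji; apply: IHm; apply: leq_trans leim.
have ts j : j < i -> t j = s j by move/st.
have elow : lower s i = lower t i by rewrite -!UD_wordD eX.
have Lst : left_record t i -> left_record s ((s^-1)%g (t i)).
  by rewrite -[in X in _ -> X]LR_wordL permKV eY LR_wordL.
have Lts : left_record s i -> left_record t ((t^-1)%g (s i)).
  by rewrite -[in X in _ -> X]LR_wordL permKV -eY LR_wordL.
apply: val_inj; apply/eqP; rewrite eqn_leq; apply/andP.
case: (posnP i) => [/eqP i0|i0].
  have -> : i = ord0 by apply/val_inj/eqP.
  have ei := first_value_le eX eY eb; have ei' := first_value_le (esym eX) (esym eY) (esym eb).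
  by case/orP: (leq_total (s ord0) (t ord0)) => le; split=> //; auto.
case: (boolP (lower s i)) => [low|nlow].
  have lowt : lower t i by rewrite -elow.
  case: (leqP i (min_pos s)) => [leb|ltb].
    rewrite lower_lrmin // in low; rewrite lower_lrmin -?eb // in lowt.
    split; first by apply: lrmin_prefix => //; [apply: Lts; rewrite /left_record low | apply/lrminP].
    by apply: lrmin_prefix => //; [apply: Lst; rewrite /left_record lowt | apply/lrminP].
  rewrite lower_rlmin // in low; rewrite lower_rlmin -?eb // in lowt.
  by split; apply: rlmin_prefix.
have lrc : lrmax s i -> lrmax t i -> (s i <= t i) /\ (t i <= s i).
  move=> ms mt; split.
    by apply: lrmax_prefix => //; [apply: Lst; rewrite /left_record mt orbT | apply/lrmaxP].
  by apply: lrmax_prefix => //; [apply: Lts; rewrite /left_record ms orbT | apply/lrmaxP].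
have := Sq_record i sS; have := Sq_record i tS; rewrite -elow (negPf nlow) /=.
case/orP=> mt /orP[] ms; first exact: lrc.
- by apply: lrc => //; apply: lrmax_rlmax_prefix ts mt ms.
- by apply: lrc => //; apply: lrmax_rlmax_prefix st ms mt.
by split; apply: rlmax_prefix.
Qed.

Lemma good_words s : good (UD_word s, LR_word s, (min_pos s).+1).
Proof.
have min0 : lrmin s ord0 by apply/lrminP.
have minm : rlmin s ord_max by apply/rlminP => j; rewrite ltnNge -ltnS ltn_ord.
have maxb : lrmax s ((s^-1)%g ord_max).
  apply/lrmaxP => j; rewrite permKV /= => ltj; rewrite ltn_neqAle -ltnS ltn_ord andbT.
  apply: contraTneq ltj => e; rewrite -[j](permK s) (_ : s j = ord_max) ?ltnn //.
  exact: val_inj.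
have minb : lrmin s (min_pos s).
  rewrite -lower_lrmin // /lower; apply/orP; right.
  apply/rlminP => j ltj; rewrite min_posK /= lt0n.
  apply: contraTneq ltj => e; rewrite -[j](permK s) (_ : s j = ord0) ?ltnn //.
  exact: val_inj.
split.
- by rewrite (UD_wordD s ord0) /lower min0.
- by rewrite (UD_wordD s ord_max) /lower minm orbT.
- by rewrite (UD_wordD s (min_pos s)) /lower minb.
- have /= := LR_wordL s (min_pos s); rewrite min_posK => ->.
  by rewrite /left_record minb.
have /= := LR_wordL s ((s^-1)%g ord_max); rewrite permKV => ->.
by rewrite /left_record maxb orbT.
Qed.


End Injectivity.

(** * The permutation and the triple attached to a balanced good triple *)

Lemma diagram_inj n : injective (@diagram n).
Proof.
move=> s t est; apply/permP => i.
have : diagram t (i.+1, (s i).+1) by rewrite -est; exists i.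
by case=> j _ [/val_inj -> /val_inj].
Qed.

Lemma rho_Some n (w : triple n) (s : {perm 'I_n}) :
  diagram s = Lambda w -> rho w = Some s.
Proof.
move=> es; rewrite /rho; case: pickP => [t /asboolP et|/(_ s)/asboolP//].
by congr Some; apply: diagram_inj; rewrite et.
Qed.

(** By [rho_fun_lt], the points of Lambda_1, ..., Lambda_4 are respectively left-to-right minima,
    left-to-right maxima, right-to-left minima and right-to-left maxima. This gives squareness and
    the letters D and L; the witnesses found for U columns and R rows give the other letters. *)
Lemma rho_balanced n E z0 (X : n.+1.-tuple UD) (Y : n.+1.-tuple LR) :
  balanced E z0 X Y -> good (X, Y, z0) ->
  exists s, [/\ rho (X, Y, z0) = Some s, s \in Sq n.+1,
    UD_word s = X, LR_word s = Y & (min_pos s).+1 = z0].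
Proof.
move=> Hb Hg; pose f := rho_fun z0 X Y.
have fb (i : 'I_n.+1) : 0 < f i.+1 <= n.+1 by apply: (rho_fun_bound Hb) => /=.
have fin (i : 'I_n.+1) : (f i.+1).-1 < n.+1.
  by case/andP: (fb i) => f0 fn; rewrite ltnS -ltnS (ltn_predK f0).
have finj : injective (fun i => Ordinal (fin i)).
  move=> i j /(congr1 val) /= e; apply/val_inj/succn_inj.
  apply: (rho_fun_inj Hb); [exact: ltn_ord | exact: ltn_ord |].
  case/andP: (fb i) => fi0 _; case/andP: (fb j) => fj0 _.
  by move: e; rewrite /f in fi0 fj0 *; case: rho_fun fi0 => // k _ /= ->; rewrite (ltn_predK fj0).
pose s := perm finj.
have sE i : (s i).+1 = f i.+1.
  by rewrite permE /=; case/andP: (fb i) => f0 _; rewrite (ltn_predK f0).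
have slt i j : (s i < s j) = (f i.+1 < f j.+1) by rewrite -!sE ltnS.
have flt (i j : 'I_n.+1) (ltij : i < j) :=
  @rho_fun_lt _ _ _ _ _ Hb i.+1 j.+1 (ltn0Sn i) ltij (ltn_ord j).
pose c1 (i : 'I_n.+1) := on_Lambda1 z0 X Y i.+1 (f i.+1).
pose c2 (i : 'I_n.+1) := on_Lambda2 z0 X Y i.+1 (f i.+1).
pose c3 (i : 'I_n.+1) := on_Lambda3 z0 X Y i.+1 (f i.+1).
pose c4 (i : 'I_n.+1) := on_Lambda4 z0 X Y i.+1 (f i.+1).
have clP (i : 'I_n.+1) : [\/ c1 i, c2 i, c3 i | c4 i].
  by case: (@rho_funP _ _ _ _ _ Hb i.+1 (ltn_ord i)).
have s1 i : c1 i -> lrmin s i.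
  by move=> ci; apply/lrminP => j /flt[H _ _ _]; rewrite slt; apply: H.
have s2 i : c2 i -> lrmax s i.
  by move=> ci; apply/lrmaxP => j /flt[_ H _ _]; rewrite slt; apply: H.
have s3 i : c3 i -> rlmin s i.
  by move=> ci; apply/rlminP => j /flt[_ _ H _]; rewrite slt; apply: H.
have s4 i : c4 i -> rlmax s i.
  by move=> ci; apply/rlmaxP => j /flt[_ _ _ H]; rewrite slt; apply: H.
have Uleft (i : 'I_n.+1) : letter_is X i.+1 U -> ~~ lower s i.
  move=> iU; rewrite /lower negb_or; apply/andP; split.
    have [[|j] [//= _ ltji lt]] := rho_fun_U_left Hb Hg iU.
    have ltj : j < n.+1 := ltn_trans (ltji : j < i) (ltn_ord i).
    apply/negP => /lrminP/(_ (Ordinal ltj) ltji).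
    by rewrite slt /= ltnNge (ltnW lt).
  have [[|j] [//= ltij ltj lt]] := rho_fun_U_right Hb Hg iU.
  apply/negP => /rlminP/(_ (Ordinal ltj) ltij).
  by rewrite slt /= ltnNge (ltnW lt).
have Rleft (i : 'I_n.+1) : letter_is Y (f i.+1) R -> ~~ left_record s i.
  move=> iR; rewrite /left_record negb_or; apply/andP; split.
    have [[|j] [//= _ ltji lt]] := @rho_fun_R_left_lower _ _ _ _ _ Hb Hg i.+1 (ltn_ord i) iR.
    have ltj : j < n.+1 := ltn_trans (ltji : j < i) (ltn_ord i).
    apply/negP => /lrminP/(_ (Ordinal ltj) ltji).
    by rewrite slt /= ltnNge (ltnW lt).
  have [[|j] [//= _ ltji lt]] := @rho_fun_R_left_upper _ _ _ _ _ Hb Hg i.+1 (ltn_ord i) iR.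
  have ltj : j < n.+1 := ltn_trans (ltji : j < i) (ltn_ord i).
  apply/negP => /lrmaxP/(_ (Ordinal ltj) ltji).
  by rewrite slt /= ltnNge (ltnW lt).
exists s; split.
- apply: rho_Some; rewrite (Lambda_rho_fun Hb); apply/seteqP; split.
    by move=> _ [i _ <-]; exists i.+1 => //=; rewrite sE.
  move=> _ [[//|i] /= lti ->]; exists (Ordinal lti) => //.
  by rewrite sE.
- rewrite inE; apply/forallP => i; rewrite /is_record.
  case: (clP i) => [/s1|/s2|/s3|/s4];
    rewrite /lrmin /lrmax /rlmin /rlmax => ->; by rewrite ?orbT.
- apply: eq_from_tnth => i; rewrite tnth_mktuple; have := letter_isS X i U.
  have := letter_isS X i D; have := @Uleft i; case: (tnth X i) => H eD eU.
    by rewrite (negPf (H _)) // eU.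
  by case: (clP i) => ci; case: (ci) => iA _ _ _; rewrite ?eU // in iA;
    rewrite /lower; first [rewrite (s1 i ci) | rewrite (s3 i ci)]; rewrite ?orbT.
- apply: eq_from_tnth => v; rewrite tnth_mktuple -(permKV s v) permK.
  move: ((s^-1)%g v) => i; have := letter_isS Y (s i) L; have := letter_isS Y (s i) R.
  rewrite sE; have := @Rleft i; case: (tnth Y (s i)) => H eR eL.
    by case: (clP i) => ci; case: (ci) => _ _ iA _; rewrite ?eR // in iA;
    rewrite /left_record; first [rewrite (s1 i ci) | rewrite (s2 i ci)]; rewrite ?orbT.
  by rewrite (negPf (H _)) // eR.
have [_ _ Xz0 _ _] := Hg; have z0n := letter_is_bound Xz0.
have ez : z0.-1.+1 = z0 by apply: ltn_predK; case/andP: z0n => z00 _; exact: z00.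
have lz : z0.-1 < n.+1 by rewrite ez; case/andP: z0n.
have : (s (Ordinal lz)).+1 = 1 by rewrite sE /= ez /f (rho_fun_z0 Hb Hg).
case=> sz; rewrite /min_pos -[ord0](_ : s (Ordinal lz) = _) ?permK //.
exact: val_inj.
Qed.

(** * Concentration of the counting functions *)

Section Fluctuations.
Local Open Scope ring_scope.
Variables (K : realType) (n : nat) (T : finType) (A : T).
Hypothesis T2 : #|T| = 2.
Implicit Types X : n.-tuple T.

(** The walk that steps up at each B and down elsewhere. *)
Definition excess (U : eqType) k (W : k.-tuple U) B (i : nat) : K :=
  2 * (ct W B i)%:R - i%:R.

(** One bound for all windows, on the natural scale of the square root of the length; this lets it
    serve the short and the long ranges of the Petrov conditions alike. *)
Definition fluct (H : K) X : bool :=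
  [forall x : 'I_n.+1, forall y : 'I_n.+1, (x <= y)%N ==>
    (`|excess X A y - excess X A x| <= 2 * H * Num.sqrt (y - x)%N%:R)].

(** Independence of the letters of a uniform word, in terms of sums. *)
Lemma sum_tuple_prod (g : 'I_n -> T -> K) :
  \sum_X \prod_(k < n) g k (tnth X k) = \prod_(k < n) \sum_t g k t.
Proof.
rewrite bigA_distr_bigA /= (reindex (fun f : {ffun 'I_n -> T} => [tuple f k | k < n])) /=.
  by apply: eq_bigr => f _; apply: eq_bigr => k _; rewrite tnth_mktuple.
exists (fun X => [ffun k => tnth X k]) => f _.
  by apply/ffunP => k; rewrite ffunE tnth_mktuple.
by apply: eq_from_tnth => k; rewrite tnth_mktuple ffunE.
Qed.

(** From exp(-x) >= 1 - x one gets exp(x) <= 1 / (1 - x), and (1 + x + 2x^2)(1 - x) = 1 + x^2 (1 -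
    2x) >= 1. *)
Lemma expR_le_quad (x : K) : x <= 1 / 2 -> expR x <= 1 + x + 2 * x ^+ 2.
Proof.
move=> x2; have h := expR_ge1Dx (- x).
have e : expR x * expR (- x) = 1 by rewrite expRN divff // gt_eqF // expR_gt0.
have h1 : 1 - x <= expR (- x) by rewrite h.
have p : 0 < expR x := expR_gt0 x.
have h2 : expR x * (1 - x) <= 1 by rewrite -[leRHS]e ler_pM2l.
have h3 : 1 <= (1 + x + 2 * x ^+ 2) * (1 - x).
  have : 0 <= x ^+ 2 * (1 - 2 * x) by rewrite mulr_ge0 ?sqr_ge0 //; lra.
  by rewrite !expr2; nra.
have pos : 0 < 1 - x by lra.
by rewrite -(ler_pM2r pos); lra.
Qed.

Lemma expR_cosh (x : K) : `|x| <= 1 / 2 ->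
  expR x + expR (- x) <= 2 * expR (2 * x ^+ 2).
Proof.
rewrite ler_norml => /andP[x1 x2].
have h1 := expR_le_quad x2; have h2 : expR (- x) <= 1 + - x + 2 * (- x) ^+ 2.
  by apply: expR_le_quad; lra.
have h3 := expR_ge1Dx (2 * x ^+ 2); rewrite sqrrN in h2; lra.
Qed.

Lemma excessS X i : (i < n)%N ->
  excess X A i.+1 = excess X A i + (2 * (letter_is X i.+1 A)%:R - 1).
Proof. by move=> ltin; rewrite /excess ctS // natrD -natr1; ring. Qed.

(** Truncating the window at i makes the induction on i work; the case i = n is the one of
    interest. *)
Lemma sum_window_excess X (lam : K) x y i : (x <= y)%N -> (i <= n)%N ->
  \sum_(k < i) (if (x <= k < y)%N then lam else 0) *
     (2 * (letter_is X k.+1 A)%:R - 1) =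
  lam * (excess X A (minn i y) - excess X A (minn i x)).
Proof.
move=> lexy; elim: i => [_|i IHi ltin].
  by rewrite big_ord0 !min0n subrr mulr0.
rewrite big_ord_recr /= IHi; last exact: ltnW.
case: (boolP (x <= i)%N) => lexi; case: (boolP (i < y)%N) => ltiy /=; last by lia.
- have -> : minn i.+1 y = i.+1 by lia.
  have -> : minn i y = i by lia.
  have -> : minn i.+1 x = x by lia.
  have -> : minn i x = x by lia.
  rewrite excessS //; ring.
- have -> : minn i.+1 y = y by lia.
  have -> : minn i y = y by lia.
  have -> : minn i.+1 x = x by lia.
  have -> : minn i x = x by lia.
  ring.
have -> : minn i.+1 y = i.+1 by lia.
have -> : minn i y = i by lia.
have -> : minn i.+1 x = i.+1 by lia.
have -> : minn i x = i by lia.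
ring.
Qed.

Lemma sum_exp_excess (lam : K) x y : (x <= y <= n)%N -> `|lam| <= 1 / 2 ->
  \sum_(X : n.-tuple T) expR (lam * (excess X A y - excess X A x)) <=
  2 ^+ n * expR (2 * lam ^+ 2 * (y - x)%N%:R).
Proof.
case/andP=> lexy leyn lam2.
(* Weight 0 outside the window turns the exponential into a product over all n letters; each outside
   letter then contributes the factor 2. *)
pose w (k : nat) : K := if (x <= k < y)%N then lam else 0.
rewrite (eq_bigr (fun X => \prod_(k < n) expR (w k * (2 * (tnth X k == A)%:R - 1)))); last first.
  move=> X _; rewrite -expR_sum; congr expR.
  have := sum_window_excess X lam lexy (leqnn n).
  have -> : minn n y = y by lia.
  have -> : minn n x = x by lia.
  by move=> <-; apply: eq_bigr => k _; rewrite letter_isS.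
rewrite (sum_tuple_prod (fun k t => expR (w k * (2 * (t == A)%:R - 1)))).
have -> : 2 ^+ n * expR (2 * lam ^+ 2 * (y - x)%N%:R) =
   \prod_(k < n) (2 * expR (2 * (w k) ^+ 2)).
  rewrite big_split /= prodr_const card_ord; congr (_ * _).
  rewrite -expR_sum; congr expR; rewrite -mulr_sumr -mulrA; congr (_ * _).
  rewrite (eq_bigr (fun k : 'I_n => if (x <= k < y)%N then lam ^+ 2 else 0)); last first.
    by move=> k _; rewrite /w; case: ifP => // _; rewrite expr0n.
  rewrite -(big_mkord predT (fun k => if (x <= k < y)%N then lam ^+ 2 else 0)) /=.
  rewrite (big_cat_nat (leq0n x) (leq_trans lexy leyn)) /= (big_cat_nat lexy leyn) /=.
  rewrite [X in X + _]big1_seq ?add0r; last first.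
    by move=> k; rewrite mem_index_iota; case: ifP => // xky kr; exfalso; lia.
  rewrite [X in _ + X]big1_seq ?addr0; last first.
    by move=> k; rewrite mem_index_iota; case: ifP => // xky kr; exfalso; lia.
  rewrite (eq_big_nat _ _ (F2 := fun=> lam ^+ 2)) => [|k -> //].
  by rewrite sumr_const_nat mulr_natr.
apply: ler_prod => k _; apply/andP; split.
  by apply: sumr_ge0 => t _; apply: expR_ge0.
have -> : \sum_t expR (w k * (2 * (t == A)%:R - 1)) = expR (w k) + expR (- w k).
  rewrite (bigD1 A) //= eqxx; congr (_ + _).
    by congr expR => /=; ring.
  rewrite (eq_bigr (fun=> expR (- w k))); last first.
    by move=> t /negPf ->; congr expR => /=; ring.
  rewrite sumr_const; have := cardC1 A; rewrite T2 /= => c1.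
  by rewrite (_ : #|_| = 1%N) ?mulr1n // -[RHS]c1; apply: eq_card.
apply: expR_cosh; rewrite /w; case: ifP => // _; rewrite normr0; lra.
Qed.

(** Markov's inequality for the exponential. *)
Lemma chernoff (lam r : K) x y : (x <= y <= n)%N -> `|lam| <= 1 / 2 ->
  (#|[set X : n.-tuple T | r <= lam * (excess X A y - excess X A x)]%SET|)%:R * expR r
  <= 2 ^+ n * expR (2 * lam ^+ 2 * (y - x)%N%:R).
Proof.
move=> xy lam2; apply: le_trans (sum_exp_excess xy lam2).
rewrite -sum1_card natr_sum mulr_suml big_mkcond /=.
apply: ler_sum => X _; rewrite inE; case: ifP => [le|_]; last exact: expR_ge0.
by rewrite mul1r ler_expR.
Qed.

Lemma ct_lip X x y : (x <= y <= n)%N -> (ct X A y <= ct X A x + (y - x))%N.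
Proof.
case/andP=> lexy leyn; rewrite !ct_count //; last exact: leq_trans leyn.
rewrite -[in X in (X <= _)%N](subnKC lexy) iotaD count_cat leq_add2l.
by rewrite -[leqRHS](size_iota (1 + x)) count_size.
Qed.

Lemma excess_lip X x y : (x <= y <= n)%N ->
  `|excess X A y - excess X A x| <= (y - x)%N%:R.
Proof.
move=> xyn; have := ct_lip X xyn; have := leq_ct X A xyn.
rewrite -(ler_nat K) -[(_ <= _ + _)%N](ler_nat K) natrD; case/andP: xyn => lexy _.
by rewrite /excess natrB // ler_norml => ? ?; apply/andP; split; lra.
Qed.

Lemma card_large_excess H x y : (x <= y <= n)%N -> 0 < H ->
  (#|[set X : n.-tuple T | ~~ (`|excess X A y - excess X A x| <=
     2 * H * Num.sqrt (y - x)%N%:R)]%SET|)%:R <= 2 ^+ n.+1 * expR (- H ^+ 2 / 2).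
Proof.
move=> xyn H0; set m : K := (y - x)%N%:R; set w := Num.sqrt m.
have m0 : 0 <= m by apply: ler0n.
have w0 : 0 <= w by apply: sqrtr_ge0.
have wm : w ^+ 2 = m by rewrite sqr_sqrtr.
(* If w < H the event is empty, since the excess is at most w^2 <= 2Hw. Otherwise the parameter
   chosen below is at most 1/2. *)
have [ltwH|leHw] := ltP w H.
  rewrite (_ : [set X | _]%SET = finset.set0) ?cards0.
    by rewrite mulr_ge0 ?exprn_ge0 ?expR_ge0.
  apply/setP => X; rewrite !inE; apply/negbTE; rewrite negbK.
  by apply: le_trans (excess_lip X xyn) _; rewrite -/m -wm expr2; nra.
have w1 : 0 < w by apply: lt_le_trans leHw.
(* With this choice the threshold 2Hw contributes H^2 to the exponent and the moment bound costs H^2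
   / 2. *)
pose lam := H / (2 * w).
have lamE : lam * (2 * H * w) = H ^+ 2 by rewrite /lam; field; rewrite gt_eqF.
have lamE2 : 2 * lam ^+ 2 * m = H ^+ 2 / 2 by rewrite -wm /lam; field; rewrite gt_eqF.
have lam0 : 0 < lam by rewrite divr_gt0 // mulr_gt0.
have lam2 : lam <= 1 / 2 by rewrite ler_pdivrMr ?mulr_gt0 //; lra.
have nlam : `|lam| <= 1 / 2 by rewrite gtr0_norm.
have nlam' : `|- lam| <= 1 / 2 by rewrite normrN.
have := chernoff (H ^+ 2) xyn nlam; have := chernoff (H ^+ 2) xyn nlam'.
rewrite -/m sqrrN lamE2 => c1 c2.
have eE : expR (H ^+ 2 / 2) = expR (- H ^+ 2 / 2) * expR (H ^+ 2).
  by rewrite -expRD; congr expR; lra.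
rewrite eE mulrA ler_pM2r ?expR_gt0 // in c1; rewrite eE mulrA ler_pM2r ?expR_gt0 // in c2.
have : [set X : n.-tuple T | ~~ (`|excess X A y - excess X A x| <= 2 * H * w)]%SET
   \subset [set X : n.-tuple T | (H ^+ 2 <= lam * (excess X A y - excess X A x))%R]%SET
       :|: [set X : n.-tuple T | (H ^+ 2 <= - lam * (excess X A y - excess X A x))%R]%SET.
  apply/fintype.subsetP => X; rewrite !inE -ltNge lter_normr => /orP[lt|lt].
    by rewrite -lamE ler_pM2l // ltW.
  by apply/orP; right; rewrite -lamE mulNr -mulrN ler_pM2l // ltW.
move/subset_leq_card; rewrite -(ler_nat K) => /le_trans; apply.
have := leq_card_setU
  [set X : n.-tuple T | (H ^+ 2 <= lam * (excess X A y - excess X A x))%R]%SET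
  [set X : n.-tuple T | (H ^+ 2 <= - lam * (excess X A y - excess X A x))%R]%SET.
case=> le _; move: le; rewrite -(ler_nat K) natrD => /le_trans; apply.
by rewrite [2 ^+ n.+1]exprS -mulrA mulr_natl mulr2n lerD.
Qed.

(** Union bound over the pairs of endpoints of windows. *)
Lemma card_not_fluct H : 0 < H ->
  (#|[set X : n.-tuple T | ~~ fluct H X]%SET|)%:R <=
  n.+1%:R ^+ 2 * (2 ^+ n.+1 * expR (- H ^+ 2 / 2)).
Proof.
move=> H0; pose bad (p : 'I_n.+1 * 'I_n.+1) := [set X : n.-tuple T |
  (p.1 <= p.2)%N && ~~ (`|excess X A p.2 - excess X A p.1| <=
     2 * H * Num.sqrt (p.2 - p.1)%N%:R)]%SET.
have badP p : (#|bad p|)%:R <= 2 ^+ n.+1 * expR (- H ^+ 2 / 2).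
  case: p => x y; rewrite /bad /=; case: (leqP x y) => lexy /=.
    by apply: card_large_excess => //; rewrite lexy -ltnS /=.
  by rewrite (_ : [set X | _]%SET = finset.set0) ?cards0 ?mulr_ge0 ?exprn_ge0 ?expR_ge0 //;
    apply/setP => X; rewrite !inE.
apply: (@le_trans _ _ (\sum_p (#|bad p|)%:R)).
  rewrite -natr_sum ler_nat -sum1_card.
  rewrite [leqRHS](eq_bigr (fun p => \sum_X (if X \in bad p then 1%N else 0%N))); last first.
    by move=> p _; rewrite -sum1_card big_mkcond.
  rewrite exchange_big /= big_mkcond /=; apply: leq_sum => X _.
  rewrite inE; case: ifPn => // /forallPn[x /forallPn[y]]; rewrite negb_imply => /andP[lexy nle].
  by rewrite (bigD1 (x, y)) //= inE lexy nle.
apply: (@le_trans _ _ (\sum_(p : 'I_n.+1 * 'I_n.+1) (2 ^+ n.+1 * expR (- H ^+ 2 / 2)))).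
  exact: ler_sum.
by rewrite sumr_const card_prod card_ord -[leLHS]mulr_natl natrM expr2.
Qed.

End Fluctuations.

(** * The Petrov conditions from the fluctuation bound *)

Section PetrovFromFluct.
Local Open Scope ring_scope.
Variables (K : realType).

(** With lengths written as powers of a suitable base, the real exponents of the Petrov conditions
    become natural numbers. *)
Lemma powR_expr (r : K) a b c e : 0 <= r -> (0 < c)%N -> (a * b = c * e)%N ->
  (r ^+ a) `^ (b%:R / c%:R) = r ^+ e.
Proof.
move=> r0 c0 abce; rewrite -powR_mulrn // -powRrM -powR_mulrn //; congr powR.
by rewrite mulrA -natrM abce natrM mulrC mulKf // pnatr_eq0 -lt0n.
Qed.

Lemma tenth_root (d : K) : 0 < d -> exists2 p : K, 0 < p & d = p ^+ 10.
Proof.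
move=> d0; exists (d `^ (1 / 10)); first exact: powR_gt0.
by rewrite -powR_mulrn ?powR_ge0 // -powRrM mulfVK ?powRr1 ?ltW // pnatr_eq0.
Qed.

(** If w >= 3s, then w^2 <= 2s^2 + sw <= (2/9 + 1/3) w^2, which is absurd. *)
Lemma sqrt_sq_bound (w k h s : K) : 0 <= w -> 0 <= h -> 0 < s ->
  w ^+ 2 <= 2 * k + 2 * h * w -> k <= s ^+ 2 -> 2 * h <= s -> w < 3 * s.
Proof. by move=> w0 h0 s0; rewrite !expr2 ltNge => ? ? ?; apply/negP; nra. Qed.

Variables (n : nat) (q : K).
Hypothesis npowR : forall b, (0 < b)%N -> n%:R `^ (b%:R / 10) = q ^+ (10 * b).
Hypothesis q10 : 10 <= q.

Let q0 : 0 < q. Proof. exact: lt_le_trans q10. Qed.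
Let q1 : 1 < q. Proof. by apply: lt_le_trans q10; rewrite ltr1n. Qed.

Lemma qpow_le a b : (a <= b)%N -> q ^+ a <= q ^+ b.
Proof. by move=> leab; rewrite ler_eXn2l. Qed.

(** One additional factor q absorbs any constant up to 10. *)
Lemma qpow_step a b (c : K) : (a < b)%N -> c <= 10 -> c * q ^+ a <= q ^+ b.
Proof.
move=> ltab c10; apply: le_trans (qpow_le ltab); rewrite exprS ler_pM2r ?exprn_gt0 //.
exact: le_trans q10.
Qed.

Section Label.
Variables (T : eqType) (X : n.-tuple T) (A : T).
Hypothesis fl : forall x y, (x <= y <= n)%N ->
  `|excess K X A y - excess K X A x| <= 2 * q ^+ 2 * Num.sqrt (y - x)%N%:R.

Lemma excess_dist i j : (i <= n)%N -> (j <= n)%N ->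
  `|excess K X A i - excess K X A j| <= 2 * q ^+ 2 * Num.sqrt `|i%:R - j%:R|.
Proof.
wlog leji : i j / (j <= i)%N.
  move=> H; case/orP: (leq_total i j) => le lein lejn; last exact: H.
  by rewrite distrC [X in Num.sqrt X]distrC; apply: H.
move=> lein lejn; have := @fl j i; rewrite leji lein => /(_ isT).
by rewrite natrB // [`|i%:R - j%:R|]ger0_norm // subr_ge0 ler_nat.
Qed.

(** The Petrov conditions on [pos] include rank 0, where the identity rests on the convention
    [pos X A 0 = 0]. *)
Lemma ct_pos i : (i <= ct X A n)%N -> ct X A (pos X A i) = i /\ (pos X A i <= n)%N.
Proof.
case: (posnP i) => [->|i0 lei]; first by rewrite pos0 ct0.
have [|Xp cp] := @pos_spec _ _ X A i; first by rewrite i0 lei.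
by split=> //; case/andP: (letter_is_bound Xp).
Qed.

(** Here q^30 is n^(3/10). The square root of d is s^5 while d^(6/10) is s^6: the spare factor s
    exceeds q^3, enough to absorb the q^2 of the fluctuation bound. *)
Lemma sqrt_lt_tenth (d s : K) : 0 < s -> q ^+ 30 < d -> d = s ^+ 10 ->
  q ^+ 3 < s /\ Num.sqrt d = s ^+ 5.
Proof.
move=> s0 dq ds; split.
  rewrite -(@ltr_pXn2r _ 10) ?nnegrE ?exprn_ge0 ?(ltW q0) ?(ltW s0) //.
  by rewrite -exprM -ds.
by rewrite ds (_ : 10 = 5 * 2)%N // exprM sqrtr_sqr ger0_norm // exprn_ge0 // ltW.
Qed.

Lemma sqrt_lt_pow (d : K) : d < q ^+ 60 -> Num.sqrt d <= q ^+ 30.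
Proof.
move=> dq; rewrite -[leRHS]ger0_norm ?exprn_ge0 ?(ltW q0) // -sqrtr_sqr -exprM.
exact/ler_wsqrtr/ltW.
Qed.

Lemma fluct_petrov_label : petrov_label K X A.
Proof.
have q2 : 0 <= q ^+ 2 := exprn_ge0 2 (ltW q0).
have ctE i j : (ct X A i)%:R - (ct X A j)%:R - 1 / 2 * (i%:R - j%:R) =
    1 / 2 * (excess K X A i - excess K X A j) :> K by rewrite /excess; field.
have half i j : (i <= n)%N -> (j <= n)%N ->
    `|(ct X A i)%:R - (ct X A j)%:R - 1 / 2 * (i%:R - j%:R)| <=
    q ^+ 2 * Num.sqrt `|i%:R - j%:R| :> K.
  move=> lei lej; rewrite ctE normrM ger0_norm; last by lra.
  by have := excess_dist lei lej; lra.
(* At the positions of the i-th and j-th A, the difference of excesses is, up to sign, pos(i) -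
   pos(j) - 2(i - j). Its bound involves the square root w of the unknown distance of the positions,
   so w satisfies a quadratic inequality, which [sqrt_sq_bound] then resolves. *)
have posE i j : (i <= ct X A n)%N -> (j <= ct X A n)%N ->
   let w := Num.sqrt `|(pos X A i)%:R - (pos X A j)%:R : K| in
   [/\ 0 <= w, `|(pos X A i)%:R - (pos X A j)%:R - 2 * (i%:R - j%:R)| <= 2 * q ^+ 2 * w &
       w ^+ 2 <= 2 * `|i%:R - j%:R| + 2 * q ^+ 2 * w].
  move=> /ct_pos[ci lei] /ct_pos[cj lej] /=; have := excess_dist lei lej.
  rewrite /excess ci cj distrC => H.
  have H1 : `|(pos X A i)%:R - (pos X A j)%:R - 2 * (i%:R - j%:R)| <=
     2 * q ^+ 2 * Num.sqrt `|(pos X A i)%:R - (pos X A j)%:R : K|.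
    by apply: le_trans H; rewrite le_eqVlt; apply/orP; left; apply/eqP; congr `|_|; ring.
  split=> //.
  rewrite sqr_sqrtr //; apply: le_trans (lerD (lexx _) H1).
  rewrite -[X in X * `|_| + _](ger0_norm (_ : 0 <= 2 :> K)) // -normrM.
  by apply: le_trans (ler_normD _ _); rewrite addrCA subrr addr0.
split=> i j lei lej; rewrite !npowR // => hd.
- apply: le_lt_trans (half _ _ lei lej) _.
  apply: (@le_lt_trans _ _ (q ^+ 2 * q ^+ 30)).
    by rewrite ler_pM2l ?exprn_gt0 // sqrt_lt_pow.
  by rewrite -exprD ltr_eXn2l.
- have d0 : 0 < `|i%:R - j%:R : K| by apply: le_lt_trans hd; apply: exprn_ge0; apply: ltW.
  have [p p0 dp] := tenth_root d0; have [qp sd] := sqrt_lt_tenth p0 hd dp.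
  apply: le_lt_trans (half _ _ lei lej) _; rewrite sd dp (@powR_expr p 10 6 10 6) ?(ltW p0) //.
  rewrite [ltRHS](_ : _ = (1 / 2 * p) * p ^+ 5); last by ring.
  rewrite ltr_pM2r ?exprn_gt0 //.
  have := @qpow_step 2 3 2 isT; lra.
- have [w0 H wH] := posE _ _ lei lej; apply: le_lt_trans H _.
  have : Num.sqrt `|(pos X A i)%:R - (pos X A j)%:R : K| < 3 * q ^+ 30.
    apply: sqrt_sq_bound wH _ _; rewrite ?exprn_gt0 //.
      by rewrite -exprM ltW.
    by apply: qpow_step => //; lra.
  rewrite -(@ltr_pM2l _ (2 * q ^+ 2)) ?mulr_gt0 ?exprn_gt0 // => /lt_le_trans; apply.
  rewrite [leLHS](_ : _ = 6 * (q ^+ 2 * q ^+ 30)); last by ring.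
  by rewrite -exprD; apply: qpow_step => //; lra.
have d0 : 0 < `|i%:R - j%:R : K| by apply: le_lt_trans hd; apply: exprn_ge0; apply: ltW.
have [p p0 dp] := tenth_root d0; have [qp sd] := sqrt_lt_tenth p0 hd dp.
have [w0 H wH] := posE _ _ lei lej; apply: le_lt_trans H _.
rewrite dp (@powR_expr p 10 6 10 6) ?(ltW p0) //.
have q3 := @qpow_step 2 3 3 isT.
have p1 : 1 <= p by have := @qpow_le 0 3 isT; rewrite expr0; lra.
have : Num.sqrt `|(pos X A i)%:R - (pos X A j)%:R : K| < 3 * p ^+ 5.
  apply: sqrt_sq_bound wH _ _; rewrite ?exprn_gt0 //.
    by rewrite -exprM dp.
  apply: (@le_trans _ _ p); first by lra.
  by rewrite -[leLHS]expr1 ler_weXn2l.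
rewrite -(@ltr_pM2l _ (2 * q ^+ 2)) ?mulr_gt0 ?exprn_gt0 // => /lt_le_trans; apply.
rewrite [p ^+ 6]exprS [leLHS](_ : _ = 2 * (3 * q ^+ 2 * p ^+ 5)); last by ring.
by rewrite ler_pM2l // ler_pM2r ?exprn_gt0 //; lra.
Qed.

End Label.

(** The excesses of the two letters are opposite, so the bound for one letter gives it for both. *)
Lemma fluct_petrov (T : finType) (X : n.-tuple T) (A B : T) :
  (forall t, (t == A) = (t != B)) -> fluct A (q ^+ 2) X -> petrov K X.
Proof.
move=> AB /forallP fX.
have flA x y : (x <= y <= n)%N ->
    `|excess K X A y - excess K X A x| <= 2 * q ^+ 2 * Num.sqrt (y - x)%N%:R.
  case/andP=> lexy leyn; have lty : (y < n.+1)%N by [].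
  have ltx : (x < n.+1)%N by apply: leq_ltn_trans lty.
  by have /forallP/(_ (Ordinal lty))/implyP := fX (Ordinal ltx); apply.
have exB i : (i <= n)%N -> excess K X B i = - excess K X A i.
  by move=> lein; rewrite /excess -{2 4}(ct_compl X AB lein) natrD; ring.
move=> C; case: (eqVneq C A) => [->|neCA]; first exact: fluct_petrov_label.
have -> : C = B by apply/eqP; rewrite -[_ == B]negbK -AB.
apply: fluct_petrov_label => x y xyn; have /andP[lexy leyn] := xyn.
rewrite !exB ?(leq_trans lexy) // -opprD normrN; exact: flA.
Qed.

End PetrovFromFluct.

(** * Counting triples *)

Lemma card_UD : #|{: UD}| = 2.
Proof.
by rewrite -card_bool; apply: (bij_eq_card (f := UD_to_bool)); exists bool_to_UD; case.
Qed.

Lemma card_LR : #|{: LR}| = 2.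
Proof.
by rewrite -card_bool; apply: (bij_eq_card (f := LR_to_bool)); exists bool_to_LR; case.
Qed.

Lemma card_ord_le_inj n (f : 'I_n -> nat) (B : {set 'I_n}) k :
  injective f -> (forall z, z \in B -> f z < k) -> #|B| <= k.
Proof.
move=> fI fB; rewrite cardE -(size_map f) -[k](size_iota 0).
apply: uniq_leq_size; first by rewrite map_inj_uniq ?enum_uniq.
by move=> _ /mapP[z + ->]; rewrite mem_enum mem_iota add0n => /fB.
Qed.

Section Counting.
Variable n : nat.
Notation N := n.+1.
Notation word_triple := (N.-tuple UD * N.-tuple LR * 'I_N)%type.

Definition to_triple (w : word_triple) : triple N := (w.1.1, w.1.2, (w.2 : nat).+1).

Definition good_triples : {set word_triple} :=
  [set w : word_triple | `[< good (to_triple w) >]]%SET.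

Lemma good_tripleP X Y (z : 'I_N) :
  (X, Y, z) \in good_triples <-> good (X, Y, (z : nat).+1).
Proof. by rewrite inE; split=> [/asboolP //|gw]; apply/asboolP. Qed.

Definition Sq_triple (s : {perm 'I_N}) : word_triple :=
  (UD_word s, LR_word s, min_pos s).

Lemma Sq_triple_inj : {in Sq N &, injective Sq_triple}.
Proof.
move=> s t sS tS e; apply: square_words_inj => //.
- exact: (congr1 (fun w : word_triple => w.1.1) e).
- exact: (congr1 (fun w : word_triple => w.1.2) e).
exact: (congr1 (fun w : word_triple => w.2) e).
Qed.

Lemma card_Sq_le : #|Sq N| <= #|good_triples|.
Proof.
rewrite -(card_in_imset Sq_triple_inj); apply/subset_leq_card/fintype.subsetP.
by move=> _ /imsetP[s _ ->]; apply/good_tripleP; apply: good_words.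
Qed.

(* Overwriting the letters that a good triple prescribes, and remembering the
   overwritten letters, is injective. *)
Lemma card_good_triples : N * 4 ^ N <= 32 * #|good_triples|.
Proof.
pose fixX (X : N.-tuple UD) (z : 'I_N) :=
  [tuple if (i == ord0) || (i == ord_max) || (i == z) then D else tnth X i | i < N].
pose fixY (Y : N.-tuple LR) :=
  [tuple if (i == ord0) || (i == ord_max) then L else tnth Y i | i < N].
pose h (w : word_triple) : word_triple * (UD * UD * UD * LR * LR) :=
  let: (X, Y, z) := w in ((fixX X z, fixY Y, z),
   (tnth X ord0, tnth X ord_max, tnth X z, tnth Y ord0, tnth Y ord_max)).
have h_inj : injective h.
  move=> [[X Y] z] [[X' Y'] z'] e.
  have eX := congr1 (fun w => w.1.1.1) e; have eY := congr1 (fun w => w.1.1.2) e.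
  move: e => [_ _ ez e1 e2 e3 e4 e5]; rewrite /= in eX eY.
  have -> : X = X'.
    apply: eq_from_tnth => i; have := congr1 (fun W : N.-tuple UD => tnth W i) eX.
    rewrite !tnth_mktuple -ez; case: eqP => [->//|_]; case: eqP => [->//|_] /=.
    by case: eqP => [->|//]; rewrite e3 ez.
  have -> : Y = Y'.
    apply: eq_from_tnth => i; have := congr1 (fun W : N.-tuple LR => tnth W i) eY.
    by rewrite !tnth_mktuple; case: eqP => [->//|_]; case: eqP => [->//|_].
  by rewrite ez.
have : #|{: word_triple}| <= #|finset.setX good_triples [set: (UD * UD * UD * LR * LR)%type]%SET|.
  rewrite -cardsT -(card_imset _ h_inj); apply/subset_leq_card/fintype.subsetP.
  move=> _ /imsetP[[[X Y] z] _ ->]; rewrite finset.in_setX finset.in_setT andbT.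
  apply/good_tripleP; split.
  - by rewrite (letter_isS _ ord0) tnth_mktuple eqxx.
  - by rewrite (letter_isS _ ord_max) tnth_mktuple eqxx orbT.
  - by rewrite (letter_isS _ z) tnth_mktuple eqxx orbT.
  - by rewrite (letter_isS _ ord0) tnth_mktuple eqxx.
  by rewrite (letter_isS _ ord_max) tnth_mktuple eqxx orbT.
rewrite cardsX cardsT !card_prod !card_tuple card_ord card_UD card_LR.
by rewrite -expnMn [in X in X -> _]mulnC [in X in X -> _](mulnC #|_|).
Qed.

Local Open Scope ring_scope.
Variables (K : realType) (q : K).

(** With n = q^100, the fluctuation parameter is n^(1/50), and q^90 is the margin n^(9/10) of
    [Omega]. *)
Definition regular_triples : {set word_triple} :=
  [set w in good_triples | [&& fluct D (q ^+ 2) w.1.1, fluct L (q ^+ 2) w.1.2,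
     q ^+ 90 <= (w.2 : nat).+1%:R & (w.2 : nat).+1%:R <= N%:R - q ^+ 90]]%SET.

Hypothesis Nq : N%:R = q ^+ 100.
Hypothesis q10 : 10 <= q.

Lemma q_gt0 : 0 < q. Proof. exact: lt_le_trans q10. Qed.

Lemma npowq b : (0 < b)%N -> N%:R `^ (b%:R / 10) = q ^+ (10 * b).
Proof.
by move=> b0; rewrite Nq (@powR_expr _ q 100 b 10 (10 * b)) ?(ltW q_gt0) // mulnA.
Qed.

(** The window from 0 to i has length at most q^100, whose square root is q^50. *)
Lemma fluct_le (T : finType) (W : N.-tuple T) B (i : nat) :
  fluct B (q ^+ 2) W -> (i <= N)%N -> `|excess K W B i| <= 2 * q ^+ 52.
Proof.
move=> /forallP/(_ ord0)/forallP fW lei.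
have := fW (Ordinal (lei : (i < N.+1)%N)); rewrite /= {2}/excess ct0 mulr0 subr0 subr0 subn0.
move=> /le_trans; apply; have q0 := ltW q_gt0.
rewrite (_ : 52 = 2 + 50)%N // exprD mulrA ler_wpM2l ?mulr_ge0 ?exprn_ge0 //.
rewrite -[leRHS]ger0_norm ?exprn_ge0 // -sqrtr_sqr -exprM -Nq.
by apply: ler_wsqrtr; rewrite ler_nat.
Qed.

Lemma regular_balanced X Y (z : 'I_N) : (X, Y, z) \in regular_triples ->
  exists E, balanced E z.+1 X Y.
Proof.
rewrite inE => /andP[_ /and4P[fX fY zlo zhi]] /=; rewrite /= in fX fY zlo zhi.
have q0 := q_gt0; have c0 : 0 <= 2 * q ^+ 52 by rewrite mulr_ge0 ?exprn_ge0 // ltW.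
have /andP[E1 E2] := truncn_itv c0.
(* E exceeds the bound of [fluct_le] by at most one, so 10E + 20 <= 20 q^52 + 30 <= 100 q^52 <=
   q^54, well below the margin q^90. *)
set E := (Num.trunc (2 * q ^+ 52)).+1; exists E.
have Elo : 2 * q ^+ 52 <= E%:R by rewrite ltW.
have Ehi : E%:R <= 2 * q ^+ 52 + 1 by rewrite /E -natr1; lra.
have big : 10 * E%:R + 20 <= q ^+ 90.
  have h : 10 * (10 * q ^+ 52) <= q ^+ 90.
    apply: (@le_trans _ _ (q * (q * q ^+ 52))).
      by rewrite [leLHS]mulrA [leRHS]mulrA ler_pM2r ?exprn_gt0 // ler_pM.
    by rewrite -!exprS ler_eXn2l //; apply: lt_le_trans q10; rewrite ltr1n.
  have : 1 <= q ^+ 52 by rewrite exprn_ege1 //; have := q10; lra.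
  lra.
have bal (T : finType) (W : N.-tuple T) B i : fluct B (q ^+ 2) W -> (i <= N)%N ->
    (i <= 2 * ct W B i + E)%N /\ (2 * ct W B i <= i + E)%N.
  move=> fW lei; have := fluct_le fW lei; rewrite ler_norml /excess => /andP[h1 h2].
  by split; rewrite -(ler_nat K) natrD natrM; lra.
split=> [x lex|y ley||]; [exact: bal|exact: bal| |].
  by rewrite -(ler_nat K) natrD natrM; lra.
by rewrite -(ler_nat K) !natrD natrM; lra.
Qed.

Lemma regular_Omega w : w \in regular_triples -> Omega K N (to_triple w).
Proof.
case: w => [[X Y] z]; rewrite inE => /andP[/good_tripleP gw /and4P[/= fX fY zlo zhi]].
have e90 : N%:R `^ (9 / 10) = q ^+ 90 by rewrite npowq.
split=> //=; last by rewrite e90.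
- by apply: fluct_petrov npowq q10 _ _ _ _ eqDU fX.
by apply: fluct_petrov npowq q10 _ _ _ _ eqLR fY.
Qed.

(** [Sq_triple] recovers each regular triple from the square permutation that [rho] assigns to it,
    so the regular triples are covered by an image of the set on the right. *)
Lemma card_regular_le : (#|regular_triples| <=
  #|[set s in Sq N | `[< rho_image K N s >]]%SET|)%N.
Proof.
have sub : {subset regular_triples <= Sq_triple @: [set s in Sq N | `[< rho_image K N s >]]%SET}.
  move=> w wr; have wO := regular_Omega wr; case: w => [[X Y] z] in wr wO *.
  have [E Eb] := regular_balanced wr.
  have gw : good (X, Y, (z : nat).+1).
    by apply/good_tripleP; move: wr; rewrite inE => /andP[].
  have [s [rs sS eX eY [ez]]] := rho_balanced Eb gw.
  apply/imsetP; exists s.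
    by rewrite inE sS; apply/asboolP; exists (X, Y, (z : nat).+1).
  by rewrite /Sq_triple eX eY; congr (_, _, _); apply: val_inj.
apply: leq_trans (subset_leq_card _) (leq_imset_card Sq_triple _).
exact/fintype.subsetP.
Qed.

(** Either z0 is close to an end, or one of the two words violates the fluctuation bound with H =
    q^2 while the other word and z0 are arbitrary. *)
Lemma card_irregular : (#|good_triples :\: regular_triples|)%:R <=
  4 ^+ N * (3 * q ^+ 90 + 4 * N%:R * N.+1%:R ^+ 2 * expR (- q ^+ 4 / 2)).
Proof.
have q0 := q_gt0; have q1 : 1 <= q ^+ 90 by rewrite exprn_ege1 //; have := q10; lra.
pose Z := [set z : 'I_N | ~~ ((q ^+ 90 <= (z : nat).+1%:R) && ((z : nat).+1%:R <= N%:R - q ^+ 90))]%SET.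
pose BX := [set X : N.-tuple UD | ~~ fluct D (q ^+ 2) X]%SET.
pose BY := [set Y : N.-tuple LR | ~~ fluct L (q ^+ 2) Y]%SET.
have sub : good_triples :\: regular_triples \subset
   finset.setX [set: N.-tuple UD * N.-tuple LR]%SET Z :|:
   (finset.setX (finset.setX BX [set: N.-tuple LR]%SET) [set: 'I_N]%SET :|:
    finset.setX (finset.setX [set: N.-tuple UD]%SET BY) [set: 'I_N]%SET).
  apply/fintype.subsetP => -[[X Y] z]; rewrite !inE /= !andbT.
  case: (`[< _ >]); rewrite ?andbF //= andbT negb_and => /orP[->|]; rewrite ?orbT //.
  by rewrite negb_and => /orP[->|->]; rewrite ?orbT.
have cZ : (#|Z|)%:R <= 3 * q ^+ 90.
  have c0 : 0 <= q ^+ 90 by lra.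
  have /andP[k1 k2] := truncn_itv c0; set k := Num.trunc _ in k1 k2.
  (* With k the integer part of q^90, at most k positions are too close to the left end and at most
     k + 1 to the right end; 2k + 1 <= 3 q^90. *)
  have : (#|Z| <= k + k.+1)%N.
    have ZU : Z \subset [set z : 'I_N | (z < k)%N]%SET :|: [set z : 'I_N | (N - z.+1 < k.+1)%N]%SET.
      apply/fintype.subsetP => z; rewrite !inE negb_and -!ltNge => /orP[lt|lt]; apply/orP; [left|right].
        by have := lt_trans lt k2; rewrite ltr_nat ltnS.
      have : (N - z.+1)%N%:R < k.+1%:R :> K by rewrite natrB //; lra.
      by rewrite ltr_nat.
    apply: leq_trans (subset_leq_card ZU) _; apply: leq_trans (leq_card_setU _ _).1 _.
    apply: leq_add; first by apply: (card_ord_le_inj (f := val)) => [|z]; [exact: val_inj|rewrite inE].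
    apply: (card_ord_le_inj (f := fun z : 'I_N => (N - z.+1)%N)) => [z z'|z]; last by rewrite inE.
    by move=> e; apply: val_inj => /=; have := ltn_ord z; have := ltn_ord z'; lia.
  by rewrite -(ler_nat K) natrD -natr1; lra.
have q20 : 0 < q ^+ 2 by rewrite exprn_gt0.
have cX := @card_not_fluct K N _ D card_UD _ q20; have cY := @card_not_fluct K N _ L card_LR _ q20.
rewrite -exprM in cX cY.
have := subset_leq_card sub; rewrite -(ler_nat K) => /le_trans; apply.
have := (leq_card_setU (finset.setX [set: N.-tuple UD * N.-tuple LR]%SET Z)
   (finset.setX (finset.setX BX [set: N.-tuple LR]%SET) [set: 'I_N]%SET :|:
    finset.setX (finset.setX [set: N.-tuple UD]%SET BY) [set: 'I_N]%SET)).1.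
rewrite -(ler_nat K) => /le_trans; apply.
have := (leq_card_setU
   (finset.setX (finset.setX BX [set: N.-tuple LR]%SET) [set: 'I_N]%SET)
    (finset.setX (finset.setX [set: N.-tuple UD]%SET BY) [set: 'I_N]%SET)).1.
rewrite natrD -(ler_nat K) natrD.
rewrite !cardsX !cardsT !card_prod !card_tuple card_ord card_UD card_LR !natrM !natrX.
rewrite -/BX -/BY in cX cY.
have e4 : 4 ^+ N = 2 ^+ N * 2 ^+ N :> K by rewrite -exprMn -natrM.
have p2 : 0 < 2 ^+ N :> K by rewrite exprn_gt0.
have N0 : 0 <= N%:R :> K by [].
have h1 : 2 ^+ N * 2 ^+ N * (#|Z|)%:R <= 2 ^+ N * 2 ^+ N * (3 * q ^+ 90).
  by rewrite ler_pM2l // mulr_gt0.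
have h2 : (#|BX|)%:R * 2 ^+ N * N%:R <=
    N.+1%:R ^+ 2 * (2 ^+ N.+1 * expR (- q ^+ 4 / 2)) * 2 ^+ N * N%:R.
  by rewrite ler_wpM2r // ler_pM2r.
have h3 : 2 ^+ N * (#|BY|)%:R * N%:R <=
    2 ^+ N * (N.+1%:R ^+ 2 * (2 ^+ N.+1 * expR (- q ^+ 4 / 2))) * N%:R.
  by rewrite ler_wpM2r // ler_pM2l.
move=> h; rewrite e4; apply: le_trans (lerD h1 (le_trans h (lerD h2 h3))) _.
by rewrite (exprS 2 N) le_eqVlt; apply/orP; left; apply/eqP; ring.
Qed.

End Counting.

(** * Asymptotic proportion of the image of rho *)

Local Open Scope classical_set_scope.
Local Open Scope ring_scope.

Lemma expRN_le (K : realType) (x : K) k : 0 < x ->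
  expR (- x) <= k.+1`!%:R / x ^+ k.+1.
Proof.
move=> x0; have f0 : 0 < k.+1`!%:R :> K by rewrite ltr0n fact_gt0.
rewrite expRN -[leRHS]invrK invf_div lef_pV2 ?posrE ?expR_gt0 ?divr_gt0 ?exprn_gt0 //.
by apply: le_trans (expR_ge1Dxn k (ltW x0)); rewrite lerDr.
Qed.

(** The exponent 204 beats the square of n + 1, which is at most 4 q^200, and leaves q^-4. It comes
    from the term of degree 51 of the exponential series. *)
Lemma expRN_q4_le (K : realType) : exists2 C : K, 0 < C &
  forall q : K, 0 < q -> expR (- q ^+ 4 / 2) <= C * (q ^+ 204)^-1.
Proof.
have [k ek] : exists k, (4 * k.+1 = 204)%N by exists 50.
exists (k.+1`!%:R * 2 ^+ k.+1).
  by rewrite mulr_gt0 ?exprn_gt0 // ltr0n fact_gt0.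
move=> q q0; have x0 : 0 < q ^+ 4 / 2 by rewrite divr_gt0 ?exprn_gt0.
rewrite mulNr; apply: le_trans (expRN_le k x0) _.
by rewrite le_eqVlt; apply/orP; left; rewrite expr_div_n -exprM ek invf_div mulrA.
Qed.

(** The first term is 3N q^-10 and the second is at most 16 C N q^-4; both negative powers of q are
    at most 1/q. *)
Lemma irregular_bound (K : realType) (C q N N1 e : K) :
  10 <= q -> 0 <= C -> 0 <= e -> 0 <= N1 -> N = q ^+ 100 -> N1 <= 2 * N ->
  e <= C * (q ^+ 204)^-1 ->
  3 * q ^+ 90 + 4 * N * N1 ^+ 2 * e <= N * ((3 + 16 * C) / q).
Proof.
move=> q10 C0 e0 N10 Nq N1N eC; have q0 : 0 < q by lra.
have N0 : 0 < N by rewrite Nq exprn_gt0.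
have inv_le k : q ^- k.+1 <= q^-1.
  by rewrite lef_pV2 ?posrE ?exprn_gt0 // -[leLHS]expr1 ler_weXn2l //; lra.
have h1 : q ^+ 90 <= N / q.
  rewrite (_ : q ^+ 90 = N * q ^- 10) ?ler_pM2l //.
  by rewrite Nq (_ : 100 = 90 + 10)%N // exprD mulfK // expf_neq0 // gt_eqF.
have h2 : N1 ^+ 2 * e <= 4 * C / q.
  have N1s : N1 ^+ 2 <= 4 * q ^+ 200.
    have -> : 4 * q ^+ 200 = (2 * N) ^+ 2 by rewrite Nq exprMn -exprM -natrX.
    by rewrite ler_pXn2r ?nnegrE // mulr_ge0 // ltW.
  apply: le_trans (ler_pM _ _ N1s eC) _; rewrite ?exprn_ge0 //.
  have -> : q ^+ 204 = q ^+ 200 * q ^+ 4 by rewrite -exprD.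
  have q200 : q ^+ 200 != 0 by rewrite expf_neq0 // gt_eqF.
  rewrite invfM; move: (q ^+ 200) q200 (inv_le 3) => z z0 v.
  have -> : 4 * z * (C * (z^-1 * q ^- 4)) = 4 * C * q ^- 4 * (z * z^-1) by ring.
  by rewrite divff // mulr1 ler_wpM2l // mulr_ge0.
move: (q ^+ 90) h1 => z h1; have : N * (N1 ^+ 2 * e) <= N * (4 * C / q).
  by rewrite ler_pM2l.
have -> : 4 * N * N1 ^+ 2 * e = 4 * (N * (N1 ^+ 2 * e)) by ring.
have -> : N * ((3 + 16 * C) / q) = 3 * (N / q) + 4 * (N * (4 * C / q)) by ring.
lra.
Qed.

(** Here 1 - r/g <= b/g, and g >= NF/32; the 32 is the loss from the five prescribed letters in
    [card_good_triples]. *)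
Lemma ratio_bound (K : realType) (r g b N F t : K) : 0 < N -> 0 < F -> 0 <= t ->
  N * F <= 32 * g -> g - r <= b -> b <= F * (N * t) -> 1 - 32 * t <= r / g.
Proof.
move=> N0 F0 t0 gN rg bt; have NF := mulr_gt0 N0 F0; have g0 : 0 < g by lra.
rewrite ler_pdivlMr //; have := ler_wpM2l t0 gN.
rewrite (_ : F * (N * t) = t * (N * F)) in bt; last by ring.
rewrite mulrBl mul1r (_ : 32 * t * g = t * (32 * g)); last by ring.
lra.
Qed.

Lemma regular_proportion (K : realType) : exists2 C : K, 0 < C &
  forall n (q : K), n.+1%:R = q ^+ 100 -> 10 <= q ->
  1 - 32 * (C / q) <= (#|regular_triples n q|)%:R / (#|good_triples n|)%:R.
Proof.
have [C C0 eC] := expRN_q4_le K; exists (3 + 16 * C); first by lra.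
move=> n q Nq q10; have q0 : 0 < q := q_gt0 q10.
apply: (@ratio_bound _ _ _ (#|good_triples n :\: regular_triples n q|)%:R
  n.+1%:R (4 ^+ n.+1)).
- exact: ltr0Sn.
- exact: exprn_gt0.
- by rewrite divr_ge0 ?ltW //; lra.
- by rewrite -natrX -!natrM ler_nat card_good_triples.
- rewrite lerBlDr -natrD ler_nat addnC -leq_subLR.
  by rewrite cardsD leq_sub2l // subset_leq_card // finset.subsetIr.
apply: le_trans (card_irregular n q10) _.
rewrite ler_pM2l ?exprn_gt0 //; apply: irregular_bound => //; first exact: ltW.
- by rewrite -natrM ler_nat; lia.
exact: eC.
Qed.

Lemma rho_image_proportion (K : realType) : exists2 C : K, 0 < C &
  forall n (q : K), n%:R = q ^+ 100 -> 10 <= q ->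
  1 - 32 * (C / q) <=
  (#|finset (fun s => (s \in Sq n) && `[< rho_image K n s >])|)%:R / (#|Sq n|)%:R.
Proof.
have [C C0 HC] := regular_proportion K; exists C => // n q nq q10.
case: n nq => [e|n nq].
  have := exprn_gt0 100 (q_gt0 q10); rewrite -e; lra.
apply: le_trans (HC n q nq q10) _.
have lr := card_regular_le nq q10; have lg := card_Sq_le n.
have := subset_leq_card (A := finset (fun s => (s \in Sq n.+1) &&
  `[< rho_image K n.+1 s >])) (B := Sq n.+1).
have -> : finset (fun s => (s \in Sq n.+1) && `[< rho_image K n.+1 s >]) \subset Sq n.+1.
  by apply/fintype.subsetP => t; rewrite inE => /andP[].
move=> /(_ isT); move: lr.
move: #|finset _| #|Sq _| #|regular_triples _ _| #|good_triples _| lg => c s r g sg rc cs.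
(* If there were no square permutation, the right side would be 0 by the convention on division by
   0, and there would be no regular triple either. *)
have [s0|s0] := posnP s.
  have -> : r = 0%N by apply/eqP; rewrite -leqn0 (leq_trans rc) // -s0.
  by rewrite mul0r divr_ge0.
apply: ler_pM; rewrite ?invr_ge0 ?ler_nat //.
by rewrite lef_pV2 ?posrE ?ler_nat ?ltr0n // (leq_trans s0).
Qed.

(** * From cardinalities to probabilities, and the limit *)

Lemma measure_preimage_seq (K : realType) d (T : measurableType d)
    (P : probability T K) (S : eqType) (f : T -> S) (r : seq S) :
  (forall s, measurable (f @^-1` [set s])) -> uniq r ->
  measurable (f @^-1` [set` r]) /\
  P (f @^-1` [set` r]) = (\sum_(s <- r) P (f @^-1` [set s]))%E.
Proof.
move=> mf; elim: r => [_|a r IHr /= /andP[ar /IHr[mr Pr]]].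
  by rewrite set_nil preimage_set0 big_nil measure0; split=> //; exact: measurable0.
have -> : f @^-1` [set` a :: r] = f @^-1` [set a] `|` f @^-1` [set` r].
  apply/seteqP; split=> t /=; rewrite inE; first by case/predU1P; [left|right].
  by case=> [->|tr]; rewrite ?eqxx // orbC tr.
split; first exact: measurableU.
have dis : f @^-1` [set a] `&` f @^-1` [set` r] = set0.
  by apply/seteqP; split=> // t /= [-> tr]; rewrite tr in ar.
by rewrite big_cons -Pr; apply: measureU.
Qed.

Lemma uniform_random_preimage (K : realType) d (T : measurableType d)
    (P : probability T K) (S : finType) (A : {set S}) (f : T -> S) (B : set S) :
  uniform_random P A f -> measurable (f @^-1` B) /\
  P (f @^-1` B) = ((#|finset (fun s => (s \in A) && `[< B s >])|)%:R / (#|A|)%:R)%:E.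
Proof.
move=> fU; pose r := enum (finset (fun s => `[< B s >])).
have -> : B = [set` r].
  by apply/seteqP; split=> s; rewrite /= mem_enum inE => /asboolP.
have [|mB PB] := @measure_preimage_seq _ _ _ P _ f r (fun s => (fU s).1).
  exact: enum_uniq.
split=> //; rewrite PB big_enum /=.
rewrite (eq_bigr (fun s => (if s \in A then (#|A|)%:R^-1 else 0)%:E)); last first.
  by move=> s _; rewrite (fU s).2.
rewrite sumEFin; congr EFin; rewrite -big_mkcondr /= sumr_const.
rewrite -[LHS]mulr_natl; congr (_%:R * _); apply: eq_card => s.
by rewrite !inE /= unfold_in /= mem_enum !inE andbC.
Qed.

Theorem lemma3p8 (K : realType) (d : nat -> measure_display)
  (T : forall n : nat, measurableType (d n))
  (P : forall n : nat, probability (T n) K)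
  (sigma : forall n : nat, T n -> {perm 'I_n})
  (sigma_uniform : forall n : nat, uniform_random (P n) (Sq n) (sigma n)) :
  P n (sigma n @^-1` rho_image K n) @[n --> \oo] --> 1%E.
Proof.
have [C C0 HC] := rho_image_proportion K.
(* A real root, so that n = q^100 holds for every n; the condition q >= 10 then holds for n
   large. *)
pose q n : K := n%:R `^ (1 / 100).
have qE n : n%:R = q n ^+ 100 :> K.
  by rewrite -powR_mulrn ?powR_ge0 // -powRrM mulfVK ?powRr1.
have q_gt (c : K) : \forall n \near \oo, c < q n.
  near=> n; have [c0|c0] := leP c 0.
    apply: le_lt_trans c0 _; apply: powR_gt0; rewrite ltr0n; near: n.
    exact: nbhs_infty_gt.
  rewrite -(@ltr_pXn2r _ 100) ?nnegrE ?powR_ge0 ?(ltW c0) // -qE.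
  by near: n; exact: nbhs_infty_gtr.
apply: (@squeeze_cvge _ _ _ _ (fun n => (1 - 32 * (C / q n))%:E) _ (fun=> 1%E)).
- near=> n; have [mB PB] := uniform_random_preimage (rho_image K n) (sigma_uniform n).
  rewrite probability_le1 // andbT PB lee_fin.
  have q10 : 10 < q n by near: n; exact: q_gt.
  exact: HC (qE n) (ltW q10).
- apply: cvg_EFin; first by near=> n.
  apply/cvgrPdist_lt => e e0; near=> n.
  have qC : 32 * C / e < q n by near: n; exact: q_gt.
  have q0 : 0 < q n by apply: le_lt_trans qC; rewrite divr_ge0 ?mulr_ge0 // ltW.
  rewrite /= opprB addrC subrK mulrA ger0_norm ?divr_ge0 ?mulr_ge0 ?(ltW q0) ?(ltW C0) //.
  by rewrite ltr_pdivrMr // [ltRHS]mulrC -ltr_pdivrMr.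
exact: cvg_cst.
Unshelve. all: by end_near.
Qed.
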